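(* If $\mathcal{A}$ is a unital separable approximately divisible C$^*$-algebra, then its similarity degree satisfies $$d(\mathcal{A})\le 5.$$
   Context: For a finite-dimensional C$^*$-algebra $\mathcal{B}\cong M_{k_1}(\mathbb{C})\oplus\cdots\oplus M_{k_r}(\mathbb{C})$, define $\mathrm{SubRank}(\mathcal{B})=\min\{k_1,\ldots,k_r\}$. A separable unital C$^*$-algebra $\mathcal{A}$ with unit $I_{\mathcal{A}}$ is approximately divisible if, for every $x_1,\ldots,x_n\in\mathcal{A}$ and $\varepsilon>0$, there is a finite-dimensional C$^*$-subalgebra $\mathcal{B}$ of $\mathcal{A}$ such that (1) $I_{\mathcal{A}}\in\mathcal{B}$; (2) $\mathrm{SubRank}(\mathcal{B})\ge 2$; (3) $\|x_iy-yx_i\|<\varepsilon$ for $i=1,\ldots,n$ and all $y\in\mathcal{B}$ with $\|y\|\le 1$. Similarity degree. For a bounded homomorphism $\pi:\mathcal{A}\to\mathcal{B}(\mathcal{H})$ (an algebra homomorphism, not assumed to preserve adjoints; $\mathcal{H}$ a Hilbert space), $\|\pi\|_{cb}=\sup_{n\ge1}\|\pi_n\|$, where $\pi_n:M_n(\mathcal{A})\to M_n(\mathcal{B}(\mathcal{H}))$, $[a_{ij}]\mapsto[\pi(a_{ij})]$. The similarity degree $d(\mathcal{A})$ of a unital C$^*$-algebra $\mathcal{A}$ is the smallest number $d$ for which there exists a constant $K$ such that every unital bounded homomorphism $\pi:\mathcal{A}\to\mathcal{B}(\mathcal{H})$, for any Hilbert space $\mathcal{H}$, satisfies $\|\pi\|_{cb}\le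 K\|\pi\|^d$ ($d(\mathcal{A})=\infty$ if no such $d$ exists). *)

(* Defs.v *)
From HB Require Import structures.
From mathcomp Require Import all_boot all_order all_algebra.
From mathcomp Require Import complex.
From mathcomp Require Import all_classical all_reals all_analysis.

Set Implicit Arguments.
Unset Strict Implicit.
Unset Printing Implicit Defensive.

Import Order.TTheory GRing.Theory Num.Theory.
Import numFieldNormedType.Exports.

Local Open Scope classical_set_scope.
Local Open Scope ring_scope.

(* Unital complex C*-algebras.  The ring structure is that of an [algType],
   so 1 != 0 and the zero algebra is excluded.  The library hierarchy does not
   allow a noncommutative ring to be a [normedModType] as well (no join below
   [numDomainType]), so the norm is a real-valued field, and [entourage_cnorm]
   says that it induces the uniformity (hence the topology) of the carrier. *)
HB.mixin Record PreUniformLmodule_Algebra_isCStar (R : realType) A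
    & PreUniformLmodule R[i] A & GRing.Algebra R[i] A := {
  cnorm : A -> R;
  entourage_cnorm : @entourage A = entourage_ (ball_ cnorm);
  cauchy_cvg_cstar : forall F : set_system A,
    ProperFilter F -> cauchy F -> exists l : A, F --> l;
  cnorm_eq0 : forall x, cnorm x = 0 -> x = 0;
  cnormD : forall x y, cnorm (x + y) <= cnorm x + cnorm y;
  cnormZ : forall (c : R[i]) x, cnorm (c *: x) = complex.Re `|c| * cnorm x;
  cnormM : forall x y, cnorm (x * y) <= cnorm x * cnorm y;
  star : A -> A;
  starK : forall x, star (star x) = x;
  starD : forall x y, star (x + y) = star x + star y;
  starZ : forall (c : R[i]) x, star (c *: x) = c^* *: star x;
  starM : forall x y, star (x * y) = star y * star x;
  cnorm_starM : forall x, cnorm (star x * x) = cnorm x ^+ 2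
}.

#[short(type="cstarAlgType")]
HB.structure Definition CStarAlgebra (R : realType) :=
  {A of PreUniformLmodule R[i] A & GRing.Algebra R[i] A
   & PreUniformLmodule_Algebra_isCStar R A}.

(* Complex Hilbert spaces, not assumed separable or nonzero.  The inner product
   is linear in its first variable and conjugate-linear in the second. *)
HB.mixin Record CompleteNormedModule_isHilbert (R : realType) H
    & CompleteNormedModule R[i] H := {
  inner : {dot H for @Num.conj R[i]};
  sqr_normr_inner : forall x : H, `|x| ^+ 2 = inner x x
}.

#[short(type="hilbertType")]
HB.structure Definition Hilbert (R : realType) :=
  {H of CompleteNormedModule R[i] H & CompleteNormedModule_isHilbert R H}.

(* Norms of [normedModType R[i]] take their (nonnegative real) values in R[i]. *)
Definition rnorm (R : realType) (V : normedModType R[i]) (x : V) : R :=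
  complex.Re `|x|.

Definition separable (T : topologicalType) : Prop :=
  exists2 D : set T, countable D & dense D.

Section FiniteDimensional.
Variables (R : realType) (A : cstarAlgType R).

Record is_cstar_subalgebra (B : set A) : Prop := {
  cstar_sub0 : B 0;
  cstar_subD : forall x y, B x -> B y -> B (x + y);
  cstar_subZ : forall (c : R[i]) x, B x -> B (c *: x);
  cstar_subM : forall x y, B x -> B y -> B (x * y);
  cstar_sub_star : forall x, B x -> B (star x);
  cstar_sub_closed : closed B
}.

Definition is_finite_dimensional (B : set A) : Prop :=
  exists (n : nat) (b : 'I_n -> A),
    B = [set x | exists c : 'I_n -> R[i], x = \sum_(i < n) c i *: b i].

(* [phi] is a *-isomorphism of M_{k 0}(C) (+) ... (+) M_{k (r-1)}(C) onto B;
   elements of the direct sum are dependent families of matrices. *)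
Record is_star_iso (r : nat) (k : 'I_r -> nat)
    (phi : (forall i, 'M[R[i]]_(k i)) -> A) (B : set A) : Prop := {
  star_isoD : forall x y, phi (fun i => x i + y i) = phi x + phi y;
  star_isoZ : forall (c : R[i]) x, phi (fun i => c *: x i) = c *: phi x;
  star_isoM : forall x y, phi (fun i => x i *m y i) = phi x * phi y;
  star_iso_star : forall x,
    phi (fun i => map_mx (@Num.conj R[i]) (x i)^T) = star (phi x);
  star_iso_inj : injective phi;
  star_iso_onto : range phi = B
}.

Definition is_subrank (B : set A) (m : nat) : Prop :=
  exists (r : nat) (k : 'I_r.+1 -> nat) (phi : (forall i, 'M[R[i]]_(k i)) -> A),
    [/\ forall i, (0 < k i)%N, is_star_iso phi B
      & m = \big[minn/k ord0]_(i < r.+1) k i].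

Definition approximately_divisible : Prop :=
  forall (n : nat) (x : 'I_n -> A) (e : R), 0 < e ->
  exists B : set A,
    [/\ is_cstar_subalgebra B, is_finite_dimensional B,
        B 1,
        exists2 m, is_subrank B m & (2 <= m)%N
      & forall (i : 'I_n) (y : A), B y -> cnorm y <= 1 ->
          cnorm (x i * y - y * x i) < e].

End FiniteDimensional.

(* sup {N' (f v) : N v <= 1} *)
Definition op_norm (R : realType) (V W : Type)
    (N : V -> \bar R) (N' : W -> \bar R) (f : V -> W) : \bar R :=
  ereal_sup [set N' (f v) | v in [set v | (N v <= 1)%E]].

Definition mx_act (T V : Type) (W : nmodType) (act : T -> V -> W) (n : nat)
    (a : 'M[T]_n) (x : 'I_n -> V) : 'I_n -> W :=
  fun i => \sum_(j < n) act (a i j) (x j).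

Section MatrixNorms.
Variable R : realType.

(* M_n(A) is the C*-algebra of adjointable operators of the Hilbert C*-module
   A^n, whose norm is |x| = |x_1^* x_1 + ... + x_n^* x_n|^(1/2): its (unique)
   C*-norm is the operator norm of left multiplication on A^n. *)
Definition module_norm (A : cstarAlgType R) (n : nat) (x : 'I_n -> A) : \bar R :=
  (Num.sqrt (cnorm (\sum_(i < n) star (x i) * x i)))%:E.

Definition cstar_mx_norm (A : cstarAlgType R) (n : nat) (a : 'M[A]_n) : \bar R :=
  op_norm (@module_norm A n) (@module_norm A n)
    (mx_act (fun x y : A => x * y) a).

(* M_n(B(H)) = B(H^n), with H^n the Hilbert space direct sum. *)
Definition hsum_norm (H : hilbertType R) (n : nat) (u : 'I_n -> H) : \bar R :=
  (Num.sqrt (\sum_(i < n) rnorm (u i) ^+ 2))%:E.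

Definition bounded_op_norm (H : hilbertType R) (T : H -> H) : \bar R :=
  op_norm (fun u : H => (rnorm u)%:E) (fun u : H => (rnorm u)%:E) T.

Definition bounded_op_mx_norm (H : hilbertType R) (n : nat) (T : 'M[H -> H]_n)
    : \bar R :=
  op_norm (@hsum_norm H n) (@hsum_norm H n) (mx_act (fun t u => t u) T).

End MatrixNorms.

Section Similarity.
Variables (R : realType) (A : cstarAlgType R).

Definition hom_norm (H : hilbertType R) (pi : A -> H -> H) : \bar R :=
  op_norm (fun a : A => (cnorm a)%:E) (@bounded_op_norm R H) pi.

Definition hom_cb_norm (H : hilbertType R) (pi : A -> H -> H) : \bar R :=
  ereal_sup [set op_norm (@cstar_mx_norm R A n) (@bounded_op_mx_norm R H n)
                         (map_mx pi) | n in [set n : nat | (1 <= n)%N]].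

Record is_unital_bounded_hom (H : hilbertType R) (pi : A -> H -> H) : Prop := {
  hom_op_linear : forall a, linear (pi a);
  hom_op_bounded : forall a, (bounded_op_norm (pi a) < +oo)%E;
  hom_linear : forall (c : R[i]) a b u, pi (c *: a + b) u = c *: pi a u + pi b u;
  homM : forall a b u, pi (a * b) u = pi a (pi b u);
  hom1 : forall u, pi 1 u = u;
  hom_bounded : (hom_norm pi < +oo)%E
}.

Definition similarity_exponent (d : R) : Prop :=
  0 <= d /\
  exists K : R, forall (H : hilbertType R) (pi : A -> H -> H),
    is_unital_bounded_hom pi ->
    (hom_cb_norm pi <= K%:E * hom_norm pi `^ d)%E.

(* The infimum is +oo when there is no exponent.  An infimum is a smallest element
   only if it is attained: this is not built into the definition. *)
Definition similarity_degree : \bar R :=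
  ereal_inf [set d%:E | d in [set d | similarity_exponent d]].

End Similarity.

(* Main.v *)
Require Import Defs.
From HB Require Import structures.
From mathcomp Require Import all_boot all_order all_algebra.
From mathcomp Require Import complex.
From mathcomp Require Import all_classical all_reals all_analysis.
From mathcomp Require Import ring lra.

(** Let [pi] be a unital bounded homomorphism of norm C and let [a] be an n x n
    matrix over A of norm at most 1.  The exponent 5 = 2 + 1 + 2 comes from a
    factorization of [a], up to a small error in each entry, as the product of
    W = V^*, a diagonal matrix with a single element t of A repeated along the
    diagonal, and V.  The norm of t is bounded by an absolute constant, and the
    images of V and W under [pi] are bounded by C^2, whatever n is
    ([approximate_factorization], [hom_column_le], [hom_row_le]).

    Such a factorization exists as soon as A contains, commuting with the
    entries of [a], the matrix units E_xy of a unital finite-dimensional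
    subalgebra whose blocks all have size at least n.  Choose n points p_1,
    ..., p_n in every block, and let t be the sum over all blocks of the
    products a_jk E_(p_j p_k).  Then t has norm at most that of [a], the sum
    over s of E_(s p_i) t E_(p_j s) is a_ij, and V is the matrix with entries
    E_(p_j s).  These are identities in a ring with involution
    ([entry_from_compression], [compression_star_mul]).

    The bound C^2 for V holds because the subalgebra is spanned by finitely
    many unitaries u_g in an orthogonal way: E_xy is the sum of c_xy,g u_g,
    where the rows of c are orthogonal.  Bessel's inequality bounds the column
    with entries E_xy, divided by the square roots of the block sizes, by C
    ([unit_op_column]), and the dual identity does the same for the row
    ([unit_op_row]).  As E_(p s) is the average of E_(p x) E_(x s) over the
    points x of the block, V is a row times a column, whence C^2
    ([amplify_le], [coamplify_le]).

    Approximate divisibility gives blocks of size at least 2 only, and matrix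
    units that commute with given elements up to an arbitrary error only.
    Every M_k with k >= 2 contains a unital image of M_2 + M_3, so the number
    of elements to control does not depend on the subalgebra.  In the quotient
    of the bounded sequences of A by the null sequences, matrix units that
    asymptotically commute with finitely many sequences commute with their
    classes, and m successive choices of M_2 + M_3 commute with each other;
    their products are matrix units whose blocks have size at least 2^m
    ([realizable_base], [realizable_tensor]).  A term of the sequences that is
    far enough gives the approximate factorization in A. *)

Set Implicit Arguments.
Unset Strict Implicit.
Unset Printing Implicit Defensive.

Import Order.TTheory GRing.Theory Num.Theory.
Import numFieldNormedType.Exports.

Local Open Scope ring_scope.

Local Notation "r ** x" := ((r%:C)%C *: x) (at level 40).

(** * Norm and involution of a C*-algebra *)

Section CStar.
Variables (R : realType) (A : cstarAlgType R).
Implicit Types x y : A.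

Lemma Re_normrC (r : R) : complex.Re `|(r%:C)%C| = `|r|.
Proof. by rewrite normc_def /= expr0n addr0 sqrtr_sqr. Qed.

Lemma cnormZr (r : R) x : cnorm ((r%:C)%C *: x) = `|r| * cnorm x.
Proof. by rewrite cnormZ Re_normrC. Qed.

Lemma cnorm0 : cnorm (0 : A) = 0.
Proof.
have := cnormZr 0 (0 : A).
by rewrite scaler0 normr0 mul0r.
Qed.

Lemma cnormN x : cnorm (- x) = cnorm x.
Proof.
by have := cnormZr (-1) x; rewrite rmorphN1 scaleN1r normrN1 mul1r.
Qed.

Lemma cnorm_ge0 x : 0 <= cnorm x.
Proof.
have := cnormD x (- x); rewrite subrr cnorm0 cnormN; lra.
Qed.

(** The C*-identity bounds the norm of x by that of its adjoint, and the
    involution exchanges the two. *)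
Lemma cnorm_star x : cnorm (star x) = cnorm x.
Proof.
have half y : cnorm y <= cnorm (star y).
  have [->|y0] := eqVneq (cnorm y) 0; first exact: cnorm_ge0.
  have yp : 0 < cnorm y by rewrite lt_def y0 cnorm_ge0.
  rewrite -(ler_pM2r yp) -expr2 -cnorm_starM; exact: cnormM.
by apply/eqP; rewrite eq_le half -{2}(starK x) half.
Qed.

Lemma star0 : star (0 : A) = 0.
Proof. by have := starZ 0 (0 : A); rewrite scale0r rmorph0 scale0r. Qed.

Lemma starN x : star (- x) = - star x.
Proof. by have := starZ (-1) x; rewrite rmorphN1 !scaleN1r. Qed.

Lemma starB x y : star (x - y) = star x - star y.
Proof. by rewrite starD starN. Qed.

Lemma starZr (r : R) x : star ((r%:C)%C *: x) = (r%:C)%C *: star x.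
Proof.
rewrite starZ; congr (_ *: _); apply/CrealP; apply/complex_realP; by exists r.
Qed.

Lemma star1 : star (1 : A) = 1.
Proof.
by have := starM (star 1) (1 : A); rewrite mulr1 starK mulr1 => <-.
Qed.

Lemma star_sum (I : Type) (r : seq I) (P : pred I) (F : I -> A) :
  star (\sum_(i <- r | P i) F i) = \sum_(i <- r | P i) star (F i).
Proof. by elim/big_rec2: _ => [|i y1 y2 _ <-]; [exact: star0|exact: starD]. Qed.

Lemma cnorm1 : cnorm (1 : A) = 1.
Proof.
have := cnorm_starM (1 : A); rewrite star1 mulr1 => h.
have n0 : cnorm (1 : A) != 0.
  by apply/eqP => /cnorm_eq0 /eqP; rewrite oner_eq0.
by apply: (mulfI n0); rewrite -expr2 -h mulr1.
Qed.

End CStar.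

(** * Real inner product and scalar matrices on a Hilbert space *)

Section RealInner.
Variables (R : realType) (H : hilbertType R).
Implicit Types x y z : H.

(** All scalars used below are real, so the real part of the inner product
    suffices and turns every norm computation into a symmetric bilinear one. *)
Definition rin x y : R := complex.Re (inner x y).

Lemma rinDl x y z : rin (x + y) z = rin x z + rin y z.
Proof. by rewrite /rin linearDl raddfD. Qed.

Lemma rinC x y : rin x y = rin y x.
Proof.
have Re_conj (z : R[i]) : complex.Re (Num.conj z) = complex.Re z by case: z.
by rewrite /rin hermC expr0 mul1r Re_conj.
Qed.

Lemma rinZl (r : R) x y : rin ((r%:C)%C *: x) y = r * rin x y.
Proof.
have Re_scale (z : R[i]) : complex.Re ((r%:C)%C * z) = r * complex.Re z.
  by case: z => a b /=; rewrite mul0r subr0.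
by rewrite /rin linearZl_LR -Re_scale.
Qed.

Lemma rin_rnorm x : rin x x = rnorm x ^+ 2.
Proof.
rewrite /rin -sqr_normr_inner /rnorm.
have := normr_ge0 x; set z := `|x|; case: z => a b.
rewrite lecE /= => /andP[/eqP -> _].
by rewrite !mul0r subr0.
Qed.

Lemma rnorm_ge0 x : 0 <= rnorm x.
Proof. by have := normr_ge0 x; rewrite lecE => /andP[]. Qed.

Lemma rin_ge0 x : 0 <= rin x x.
Proof. by rewrite rin_rnorm sqr_ge0. Qed.

Lemma rinDr x y z : rin x (y + z) = rin x y + rin x z.
Proof. by rewrite rinC rinDl !(rinC _ x). Qed.

Lemma rinZr (r : R) x y : rin x ((r%:C)%C *: y) = r * rin x y.
Proof. by rewrite rinC rinZl rinC. Qed.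

Lemma rinNl x y : rin (- x) y = - rin x y.
Proof. by rewrite -scaleN1r -(rmorphN1 (real_complex R)) rinZl mulN1r. Qed.

Lemma rinNr x y : rin x (- y) = - rin x y.
Proof. by rewrite rinC rinNl rinC. Qed.

Lemma rin0l y : rin 0 y = 0.
Proof. by rewrite -(scale0r (0 : H)) -(rmorph0 (real_complex R)) rinZl mul0r. Qed.

Lemma rin_suml (I : Type) (s : seq I) (P : pred I) (F : I -> H) y :
  rin (\sum_(i <- s | P i) F i) y = \sum_(i <- s | P i) rin (F i) y.
Proof.
by elim/big_rec2: _ => [|i z1 z2 _ <-]; [exact: rin0l|exact: rinDl].
Qed.

Lemma rin_sumr (I : Type) (s : seq I) (P : pred I) (F : I -> H) y :
  rin y (\sum_(i <- s | P i) F i) = \sum_(i <- s | P i) rin y (F i).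
Proof. by rewrite rinC rin_suml; apply: eq_bigr => i _; rewrite rinC. Qed.

Lemma rnorm0_eq0 x : rnorm x = 0 -> x = 0.
Proof.
rewrite /rnorm => h; apply/eqP; rewrite -normr_eq0; apply/eqP.
by have := normr_ge0 x; move: h; case: `|x| => a b /= ->; rewrite lecE /= => /andP[/eqP -> _].
Qed.

Lemma rnormZr (r : R) x : rnorm ((r%:C)%C *: x) = `|r| * rnorm x.
Proof.
apply/eqP; rewrite -(@eqrXn2 _ 2) ?mulr_ge0 ?rnorm_ge0 //.
by rewrite -rin_rnorm rinZl rinZr rin_rnorm exprMn real_normK ?num_real // expr2 !mulrA.
Qed.

Lemma rin_rnorm_sub2 x y :
  rnorm (x - y) ^+ 2 = rnorm x ^+ 2 - rin x y *+ 2 + rnorm y ^+ 2.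
Proof.
rewrite -!rin_rnorm rinDl !rinDr !rinNl !rinNr (rinC y x); lra.
Qed.

Lemma rnormD_sqr_le x y :
  rnorm (x + y) ^+ 2 <= rnorm x ^+ 2 *+ 2 + rnorm y ^+ 2 *+ 2.
Proof.
have := rin_ge0 (x - y); rewrite -!rin_rnorm !rinDl !rinDr !rinNl !rinNr.
by rewrite (rinC y x) !mulr2n; lra.
Qed.

End RealInner.

Section ScalarMatrices.
Variables (R : realType) (H : hilbertType R) (I G : finType).
Variables (b : I -> G -> R) (w : I -> R) (P : pred I).
Hypothesis orth : forall i j, P i -> P j ->
  \sum_g b i g * b j g = (i == j)%:R * w i.

Lemma rnorm_mix_rows (f : I -> H) :
  \sum_g rnorm (\sum_(i | P i) b i g ** f i) ^+ 2
  = \sum_(i | P i) w i * rnorm (f i) ^+ 2.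
Proof.
under eq_bigr => g _ do rewrite -rin_rnorm rin_suml.
under eq_bigr => g _ do under eq_bigr => i _ do rewrite rin_sumr.
rewrite exchange_big /=; apply: eq_bigr => i Pi.
rewrite exchange_big /= (bigD1 i) //= [X in _ + X]big1 ?addr0 => [|j /andP[Pj ji]].
  under eq_bigr => g _ do rewrite rinZl rinZr mulrA.
  by rewrite -mulr_suml orth // eqxx mul1r rin_rnorm.
under eq_bigr => g _ do rewrite rinZl rinZr mulrA.
by rewrite -mulr_suml orth // eq_sym (negbTE ji) !mul0r.
Qed.

(** Bessel's inequality: [c] lists the Fourier coefficients of [f] along the
    rows of [b], and the residual of [f] has nonnegative square norm. *)
Lemma rnorm_mix_cols (f : G -> H) : (forall i, P i -> 0 < w i) ->
  \sum_(i | P i) (w i)^-1 * rnorm (\sum_g b i g ** f g) ^+ 2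
  <= \sum_g rnorm (f g) ^+ 2.
Proof.
move=> wpos; pose c i := (w i)^-1 ** \sum_g b i g ** f g.
have : 0 <= \sum_g rnorm (f g - \sum_(i | P i) b i g ** c i) ^+ 2.
  by apply: sumr_ge0 => g _; rewrite sqr_ge0.
under eq_bigr => g _ do rewrite rin_rnorm_sub2.
rewrite big_split /= sumrB rnorm_mix_rows.
have -> : \sum_(i | P i) w i * rnorm (c i) ^+ 2 =
    \sum_(i | P i) (w i)^-1 * rnorm (\sum_g b i g ** f g) ^+ 2.
  apply: eq_bigr => i Pi; rewrite /c rnormZr exprMn real_normK ?num_real //.
  by rewrite expr2 -mulrA mulVKf // gt_eqF // wpos.
suff -> : \sum_g rin (f g) (\sum_(i | P i) b i g ** c i) *+ 2 =
    \sum_(i | P i) (w i)^-1 * rnorm (\sum_g b i g ** f g) ^+ 2 *+ 2.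
  rewrite sumrMnl; set s := \sum_g _; set t := \sum_(i | P i) _.
  by rewrite mulr2n; lra.
rewrite !sumrMnl; congr (_ *+ 2).
under eq_bigr => g _ do rewrite rin_sumr.
rewrite exchange_big; apply: eq_bigr => i Pi /=.
under eq_bigr => g _ do rewrite rinZr /c rinZr mulrCA.
rewrite -mulr_sumr -rin_rnorm rin_suml; congr (_ * _).
by apply: eq_bigr => g _; rewrite rinZl.
Qed.

End ScalarMatrices.

(** Bessel's inequality for the single row with all entries 1. *)
Lemma rnorm_sum_sqr_le (R : realType) (H : hilbertType R) (G : finType)
    (f : G -> H) :
  rnorm (\sum_g f g) ^+ 2 <= #|G|%:R * \sum_g rnorm (f g) ^+ 2.
Proof.
have [G0|G0] := posnP #|G|.
  rewrite big1 => [|g _]; last by have := card0_eq G0 g; rewrite inE.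
  by rewrite -rin_rnorm rin0l mulr_ge0 // sumr_ge0 // => g _; rewrite sqr_ge0.
have orth1 (i j : unit) : predT i -> predT j ->
    \sum_(g : G) 1 * 1 = (i == j)%:R * #|G|%:R :> R.
  by case: i j => [] [] _ _; rewrite mul1r sumr_const eqxx mul1r.
have := rnorm_mix_cols orth1 f (fun _ _ => ltac:(by rewrite ltr0n)).
rewrite (big_pred1 tt) /=; last by case.
by under eq_bigr => g _ do rewrite scale1r; rewrite ler_pdivrMl ?ltr0n.
Qed.

(** * Frames: matrix units expanded along unitaries *)

(** The combinatorics of an algebra M_k1 + ... + M_kr together with a spanning
    family of unitaries.  Matrix units are indexed by pairs of points of the
    same class (a class is a block); [emb c] chooses points in the block [c], so
    that every block has size at least that of [J]; [coef x y] lists the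
    coefficients of the matrix unit E_xy along the unitaries indexed by [gen].
    The normalization k / N in [coef_orth], with k the block size and N the
    number of unitaries, is that of the trace: for a group of unitaries acting
    irreducibly and inequivalently on the blocks it is Schur orthogonality. *)
Record frame (R : realType) (J : finType) := Frame {
  pt : finType;
  cl : finType;
  gen : finType;
  cls : pt -> cl;
  emb : cl -> J -> pt;
  coef : pt -> pt -> gen -> R;
  cls_emb : forall c j, cls (emb c j) = c;
  emb_inj : forall c, injective (emb c);
  gen_gt0 : (0 < #|gen|)%N;
  coef_orth : forall x y z w, cls x = cls y -> cls z = cls w ->
    \sum_g coef x y g * coef z w g
    = ((x, y) == (z, w))%:R * (#|[pred t | cls t == cls x]|%:R / #|gen|%:R)
}.

Definition csize (R : realType) (J : finType) (F : frame R J) (x : pt F) : R :=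
  #|[pred t | cls t == cls x]|%:R.

Lemma csize_gt0 (R : realType) (J : finType) (F : frame R J) (x : pt F) :
  0 < csize x.
Proof. by rewrite ltr0n; apply/card_gt0P; exists x; rewrite inE. Qed.

Lemma csize_cls (R : realType) (J : finType) (F : frame R J) (x y : pt F) :
  cls x = cls y -> csize x = csize y.
Proof. by rewrite /csize => ->. Qed.

Definition frame_unit (R : realType) (J : finType) (F : frame R J)
    (V : lmodType R[i]) (u : gen F -> V) (x y : pt F) : V :=
  \sum_g coef x y g ** u g.

(** * Rows and columns of matrix units acting on a Hilbert space *)

(** [T g] stands for the image of the unitary indexed by [g] under a bounded
    homomorphism; it is not unitary, only bounded by [C].  A whole row or
    column of matrix units costs this bound only once. *)
Section RowsAndColumns.
Variables (R : realType) (H : hilbertType R) (J : finType) (F : frame R J).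
Variables (C : R) (T : gen F -> H -> H).
Hypothesis T_le : forall g u, rnorm (T g u) <= C * rnorm u.
Hypothesis TD : forall g u v, T g (u + v) = T g u + T g v.
Hypothesis TZ : forall g (r : R) u, T g (r ** u) = r ** T g u.

Definition unit_op (T : gen F -> H -> H) (x y : pt F) (u : H) : H :=
  frame_unit (fun g => T g u) x y.

Let T_sqr_le g u : rnorm (T g u) ^+ 2 <= C ^+ 2 * rnorm u ^+ 2.
Proof. by rewrite -exprMn lerXn2r ?nnegrE ?(le_trans _ (T_le g u)) ?rnorm_ge0. Qed.

Let T_sum g (I : finType) (P : pred I) (f : I -> H) :
  T g (\sum_(i | P i) f i) = \sum_(i | P i) T g (f i).
Proof.
apply: (big_morph (T g)) => [u v|]; first exact: TD.
by have := TZ g 0 0; rewrite rmorph0 !scale0r.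
Qed.

Variables (I : finType) (P : pred I) (l : I -> pt F * pt F).
Hypothesis l_inj : injective l.
Hypothesis l_cls : forall i, P i -> cls (l i).1 = cls (l i).2.

Let orth i j : P i -> P j ->
  \sum_g coef (l i).1 (l i).2 g * coef (l j).1 (l j).2 g
  = (i == j)%:R * (csize (l i).1 / #|gen F|%:R).
Proof.
move=> Pi Pj; rewrite coef_orth; [|exact: l_cls..].
by rewrite -!surjective_pairing (inj_eq l_inj).
Qed.

Let gen_pos : 0 < #|gen F|%:R :> R.
Proof. by rewrite ltr0n gen_gt0. Qed.

(** The column of matrix units is a scalar matrix with orthogonal rows applied
    to the family of all [T g u], to which Bessel's inequality applies. *)
Lemma unit_op_column (u : H) :
  \sum_(i | P i) (csize (l i).1)^-1 * rnorm (unit_op T (l i).1 (l i).2 u) ^+ 2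
  <= C ^+ 2 * rnorm u ^+ 2.
Proof.
rewrite -(ler_pM2l gen_pos) mulr_sumr.
have := rnorm_mix_cols orth (fun g => T g u)
  (fun i _ => divr_gt0 (csize_gt0 _) gen_pos).
under eq_bigr => i _ do rewrite invf_div -mulrA.
move=> h; apply: le_trans h _.
rewrite mulr_natl -sumr_const.
by apply: ler_sum => g _; exact: T_sqr_le.
Qed.

(** Dual form: the scalar matrix acts before the operators [T g], and the
    Cauchy-Schwarz inequality for the sum over [g] compensates for the factor
    1 / N in the orthogonality relations. *)
Lemma unit_op_row (f : I -> H) :
  rnorm (\sum_(i | P i) unit_op T (l i).1 (l i).2 (f i)) ^+ 2
  <= C ^+ 2 * \sum_(i | P i) csize (l i).1 * rnorm (f i) ^+ 2.
Proof.
have -> : \sum_(i | P i) unit_op T (l i).1 (l i).2 (f i)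
    = \sum_g T g (\sum_(i | P i) coef (l i).1 (l i).2 g ** f i).
  rewrite exchange_big; apply: eq_bigr => g _.
  by rewrite T_sum; apply: eq_bigr => i _; rewrite TZ.
apply: le_trans (rnorm_sum_sqr_le _) _.
have := rnorm_mix_rows orth f => e.
rewrite -(ler_pdivlMl _ _ gen_pos).
apply: le_trans (ler_sum _ (fun g _ => T_sqr_le g _)) _.
rewrite -mulr_sumr e mulrCA; apply: ler_wpM2l; first exact: sqr_ge0.
by rewrite mulr_sumr ler_sum // => i _; rewrite mulrAC mulrC.
Qed.

End RowsAndColumns.

Section Amplification.
Variables (R : realType) (H : hilbertType R) (J : finType) (F : frame R J).
Variables (C : R) (T : gen F -> H -> H).
Hypothesis T_le : forall g u, rnorm (T g u) <= C * rnorm u.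
Hypothesis TD : forall g u v, T g (u + v) = T g u + T g v.
Hypothesis TZ : forall g (r : R) u, T g (r ** u) = r ** T g u.
Local Notation e := (unit_op T).

Let eZ x y (r : R) u : e x y (r ** u) = r ** e x y u.
Proof.
rewrite /unit_op scaler_sumr; apply: eq_bigr => g _.
by rewrite TZ !scalerA mulrC.
Qed.

Let rnorm_scaleV (k : R) (u : H) : 0 < k ->
  k * rnorm (k^-1 ** u) ^+ 2 = k^-1 * rnorm u ^+ 2.
Proof.
move=> k0; rewrite rnormZr exprMn real_normK ?num_real // mulrA.
by rewrite (expr2 k^-1) (mulrA k) divff ?mul1r // gt_eqF.
Qed.

Let emb_pair (s : pt F) (i : J * pt F) := (emb (cls s) i.1, i.2).

Let emb_pair_inj s : injective (emb_pair s).
Proof. by move=> [j x] [k y] [] /emb_inj -> ->. Qed.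

Let emb_pair_cls s i : cls i.2 == cls s ->
  cls (emb_pair s i).1 = cls (emb_pair s i).2.
Proof. by move=> /eqP /= ->; rewrite cls_emb. Qed.

Let swap (i : pt F * pt F) := (i.2, i.1).

Let swap_inj : injective swap.
Proof. by move=> [x s] [y t] [] -> ->. Qed.

Let swap_cls i : cls i.2 == cls i.1 -> cls (swap i).1 = cls (swap i).2.
Proof. by move/eqP. Qed.

(** The matrix of all E_(emb j, s) is bounded by C^2.  Since E_(emb j, s) is the
    average over x of E_(emb j, x) E_(x, s), it is, for fixed s, a row applied
    to vectors of the form E_(x, s) (f j), and these form a column once s
    varies. *)
Lemma amplify_le (f : J -> H) :
  \sum_s rnorm (\sum_j (csize s)^-1 **
     \sum_(x | cls x == cls s) e (emb (cls s) j) x (e x s (f j))) ^+ 2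
  <= C ^+ 4 * \sum_j rnorm (f j) ^+ 2.
Proof.
have row s : rnorm (\sum_j (csize s)^-1 **
     \sum_(x | cls x == cls s) e (emb (cls s) j) x (e x s (f j))) ^+ 2
  <= C ^+ 2 * \sum_j \sum_(x | cls x == cls s)
       (csize x)^-1 * rnorm (e x s (f j)) ^+ 2.
  have -> : \sum_j (csize s)^-1 **
       \sum_(x | cls x == cls s) e (emb (cls s) j) x (e x s (f j)) =
     \sum_(i | cls i.2 == cls s) e (emb_pair s i).1 (emb_pair s i).2
       ((csize s)^-1 ** e i.2 s (f i.1)).
    rewrite -(pair_big_dep predT (fun _ x => cls x == cls s)
      (fun j x => e (emb (cls s) j) x ((csize s)^-1 ** e x s (f j)))).
    apply: eq_bigr => j _; rewrite scaler_sumr.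
    by apply: eq_bigr => x _; rewrite eZ.
  rewrite (pair_big_dep predT (fun _ x => cls x == cls s)
      (fun j x => (csize x)^-1 * rnorm (e x s (f j)) ^+ 2)).
  apply: le_trans (unit_op_row T_le TD TZ (@emb_pair_inj s)
    (@emb_pair_cls s) _) _.
  rewrite ler_wpM2l ?sqr_ge0 // ler_sum // => i /eqP Pi.
  rewrite (@csize_cls _ _ _ (emb_pair s i).1 s) ?cls_emb // (csize_cls Pi).
  by rewrite rnorm_scaleV // csize_gt0.
apply: le_trans (ler_sum _ (fun s _ => row s)) _.
rewrite -mulr_sumr (exprD C 2 2) -mulrA ler_wpM2l ?sqr_ge0 // exchange_big /=.
rewrite mulr_sumr; apply: ler_sum => j _.
rewrite (pair_big_dep predT (fun s x => cls x == cls s)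
  (fun s x => (csize x)^-1 * rnorm (e x s (f j)) ^+ 2)) /=.
by have := unit_op_column T_le swap_inj swap_cls (f j).
Qed.

(** The same bound for the transposed matrix, in the order of multiplication
    that taking adjoints produces. *)
Lemma coamplify_le (f : pt F -> H) :
  \sum_j rnorm (\sum_s (csize s)^-1 **
     \sum_(x | cls x == cls s) e x s (e (emb (cls s) j) x (f s))) ^+ 2
  <= C ^+ 4 * \sum_s rnorm (f s) ^+ 2.
Proof.
have row j : rnorm (\sum_s (csize s)^-1 **
     \sum_(x | cls x == cls s) e x s (e (emb (cls s) j) x (f s))) ^+ 2
  <= C ^+ 2 * \sum_s \sum_(x | cls x == cls s)
       (csize s)^-1 * rnorm (e (emb (cls s) j) x (f s)) ^+ 2.
  have -> : \sum_s (csize s)^-1 **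
     \sum_(x | cls x == cls s) e x s (e (emb (cls s) j) x (f s)) =
     \sum_(i | cls i.2 == cls i.1) e (swap i).1 (swap i).2
       ((csize i.1)^-1 ** e (emb (cls i.1) j) i.2 (f i.1)).
    rewrite -(pair_big_dep predT (fun s x => cls x == cls s)
      (fun s x => e x s ((csize s)^-1 ** e (emb (cls s) j) x (f s)))).
    apply: eq_bigr => s _; rewrite scaler_sumr.
    by apply: eq_bigr => x _; rewrite eZ.
  rewrite (pair_big_dep predT (fun s x => cls x == cls s)
      (fun s x => (csize s)^-1 * rnorm (e (emb (cls s) j) x (f s)) ^+ 2)).
  apply: le_trans (unit_op_row T_le TD TZ swap_inj swap_cls _) _.
  rewrite ler_wpM2l ?sqr_ge0 // ler_sum // => i /eqP Pi /=.
  by rewrite (csize_cls Pi) rnorm_scaleV // csize_gt0.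
apply: le_trans (ler_sum _ (fun j _ => row j)) _.
rewrite -mulr_sumr (exprD C 2 2) -mulrA ler_wpM2l ?sqr_ge0 // exchange_big /=.
rewrite mulr_sumr; apply: ler_sum => s _.
rewrite (pair_big_dep predT (fun _ x => cls x == cls s)
  (fun j x => (csize s)^-1 * rnorm (e (emb (cls s) j) x (f s)) ^+ 2)) /=.
have := unit_op_column T_le (@emb_pair_inj s) (@emb_pair_cls s) (f s).
apply: le_trans; apply: ler_sum => i _ /=.
by rewrite (@csize_cls _ _ _ (emb _ _) s) ?cls_emb.
Qed.

End Amplification.

(** * Bounded sequences modulo null sequences *)

Section BoundedSequences.
Variables (R : realType) (A : cstarAlgType R).

Definition bounded_seq : pred (nat -> A) :=
  fun x => `[< exists M, forall N, cnorm (x N) <= M >].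

Fact bounded_seq_subring : subring_closed bounded_seq.
Proof.
split=> [|x y /asboolP[M hM] /asboolP[M' hM']|x y /asboolP[M hM] /asboolP[M' hM']].
- by apply/asboolP; exists 1 => N; rewrite [X in cnorm X]/GRing.one /= cnorm1.
- apply/asboolP; exists (M + M') => N; apply: le_trans (cnormD _ _) _.
  by rewrite cnormN lerD.
- apply/asboolP; exists (M * M') => N; apply: le_trans (cnormM _ _) _.
  by rewrite ler_pM // cnorm_ge0.
Qed.

Fact bounded_seq_scaler : GRing.scaler_closed bounded_seq.
Proof.
move=> c x /asboolP[M hM]; apply/asboolP; exists (complex.Re `|c| * M) => N.
rewrite cnormZ ler_wpM2l //.
by have := normr_ge0 c; rewrite lecE => /andP[].
Qed.

Fact bounded_seq_submod : subsemimod_closed bounded_seq.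
Proof.
have [h1 hB _] := bounded_seq_subring.
have h0 : 0 \in bounded_seq by rewrite -(subrr 1); exact: hB.
split; last exact: bounded_seq_scaler.
split=> // x y hx hy; rewrite -[y]opprK; apply: (hB) => //.
by rewrite -sub0r; exact: hB.
Qed.

Record bdseq := BdSeq { bdval :> nat -> A; bdvalP : bounded_seq bdval }.
HB.instance Definition _ := [isSub for bdval].
HB.instance Definition _ := [Choice of bdseq by <:].
HB.instance Definition _ := GRing.SubChoice_isSubPzRing.Build
  (nat -> A) bounded_seq bdseq bounded_seq_subring.
HB.instance Definition _ := GRing.SubZmodule_isSubLmodule.Build
  R[i] (nat -> A) bounded_seq bdseq bounded_seq_submod.

Definition null_seq : pred bdseq :=
  fun x => `[< forall e : R, 0 < e ->
    exists N0, forall N, (N0 <= N)%N -> cnorm (bdval x N) < e >].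

Fact null_seq_zmod : zmod_closed null_seq.
Proof.
split=> [|x y /asboolP hx /asboolP hy]; apply/asboolP => e e0.
  by exists 0%N => N _; rewrite cnorm0.
have [N1 h1] := hx _ (divr_gt0 e0 (ltr0Sn _ 1)).
have [N2 h2] := hy _ (divr_gt0 e0 (ltr0Sn _ 1)).
exists (maxn N1 N2) => N; rewrite geq_max => /andP[l1 l2].
apply: le_lt_trans (cnormD _ _) _; rewrite cnormN [e]splitr.
by rewrite ltrD // ?h1 ?h2.
Qed.

HB.instance Definition _ :=
  GRing.isZmodClosed.Build bdseq null_seq null_seq_zmod.

Lemma null_seqMl x y : y \in null_seq -> x * y \in null_seq.
Proof.
move=> /asboolP hy; apply/asboolP => e e0.
have /asboolP[M hM] := bdvalP x.
have M1 : 0 < `|M| + 1 by rewrite ltr_wpDl.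
have [N0 h] := hy _ (divr_gt0 e0 M1).
exists N0 => N /h; rewrite ltr_pdivlMr // mulrC; apply: le_lt_trans.
apply: le_trans (cnormM _ _) _; rewrite ler_wpM2r ?cnorm_ge0 //.
by apply: le_trans (hM N) _; apply: le_trans (ler_norm _) _; rewrite lerDl.
Qed.

Lemma null_seqMr x y : x \in null_seq -> x * y \in null_seq.
Proof.
move=> /asboolP hx; apply/asboolP => e e0.
have /asboolP[M hM] := bdvalP y.
have M1 : 0 < `|M| + 1 by rewrite ltr_wpDl.
have [N0 h] := hx _ (divr_gt0 e0 M1).
exists N0 => N /h; rewrite ltr_pdivlMr //; apply: le_lt_trans.
apply: le_trans (cnormM _ _) _; rewrite ler_wpM2l ?cnorm_ge0 //.
by apply: le_trans (hM N) _; apply: le_trans (ler_norm _) _; rewrite lerDl.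
Qed.

Lemma null_seqZ (c : R[i]) x : x \in null_seq -> c *: x \in null_seq.
Proof.
move=> /asboolP hx; apply/asboolP => e e0.
set M := complex.Re `|c|.
have M1 : 0 < `|M| + 1 by rewrite ltr_wpDl.
have [N0 h] := hx _ (divr_gt0 e0 M1).
exists N0 => N /h; rewrite ltr_pdivlMr // mulrC; apply: le_lt_trans.
rewrite cnormZ ler_wpM2r ?cnorm_ge0 // -/M.
by apply: le_trans (ler_norm _) _; rewrite lerDl.
Qed.

Fact star_seqP (x : bdseq) : bounded_seq (fun N => star (x N)).
Proof.
have /asboolP[M hM] := bdvalP x.
by apply/asboolP; exists M => N; rewrite cnorm_star.
Qed.
Definition star_seq (x : bdseq) : bdseq := BdSeq (star_seqP x).

Fact const_seqP (a : A) : bounded_seq (fun=> a).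
Proof. by apply/asboolP; exists (cnorm a). Qed.
Definition const_seq a : bdseq := BdSeq (const_seqP a).

(** The quotient ring turns asymptotic relations between sequences of A into
    equalities.  Norm inequalities are read off at a single index far enough. *)
Definition null_ideal : zmodClosed bdseq := GRing.ZmodClosed.clone bdseq null_seq _.
Definition aseq := Quotient.quot null_ideal.
HB.instance Definition _ := GRing.Zmodule.on aseq.

Definition germ (x : bdseq) : aseq := (\pi_aseq x)%qT.

Lemma germ_eq x y : germ x = germ y <-> x - y \in null_seq.
Proof.
by split=> [/eqP|h]; [|apply/eqP]; rewrite -(Quotient.idealrBE null_ideal).
Qed.

Lemma germ_repr (q : aseq) : germ (repr q) = q. Proof. exact: reprK. Qed.

Fact germ_is_zmod_morphism : zmod_morphism germ.
Proof. exact: raddfB. Qed.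
HB.instance Definition _ :=
  GRing.isZmodMorphism.Build bdseq aseq germ germ_is_zmod_morphism.

Definition aseq_mul (p q : aseq) : aseq := germ (repr p * repr q).

Lemma germM_def x y : germ (x * y) = aseq_mul (germ x) (germ y).
Proof.
have hr z : z - repr (germ z) \in null_seq by apply/germ_eq; rewrite germ_repr.
apply/germ_eq; set x' := repr (germ x); set y' := repr (germ y).
rewrite -[X in X - _](subrK (x' * y)) -mulrBl -addrA -mulrBr.
apply: rpredD; [apply: null_seqMr|apply: null_seqMl]; exact: hr.
Qed.

Let germP (q : aseq) : exists x, q = germ x.
Proof. by exists (repr q); rewrite germ_repr. Qed.

Fact aseq_mulA : associative aseq_mul.
Proof.
move=> p q r; case: (germP p) (germP q) (germP r) => x -> [y ->] [z ->].
by rewrite -!germM_def mulrA.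
Qed.
Fact aseq_mul1 : left_id (germ 1) aseq_mul.
Proof. by move=> p; case: (germP p) => x ->; rewrite -germM_def mul1r. Qed.
Fact aseq_1mul : right_id (germ 1) aseq_mul.
Proof. by move=> p; case: (germP p) => x ->; rewrite -germM_def mulr1. Qed.
Fact aseq_mulDl : left_distributive aseq_mul +%R.
Proof.
move=> p q r; case: (germP p) (germP q) (germP r) => x -> [y ->] [z ->].
by rewrite -raddfD -!germM_def mulrDl raddfD.
Qed.
Fact aseq_mulDr : right_distributive aseq_mul +%R.
Proof.
move=> p q r; case: (germP p) (germP q) (germP r) => x -> [y ->] [z ->].
by rewrite -raddfD -!germM_def mulrDr raddfD.
Qed.

HB.instance Definition _ := GRing.Zmodule_isPzRing.Build aseq
  aseq_mulA aseq_mul1 aseq_1mul aseq_mulDl aseq_mulDr.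

Fact germ_is_monoid_morphism : monoid_morphism germ.
Proof. by split=> // x y; rewrite germM_def. Qed.
HB.instance Definition _ :=
  GRing.isMonoidMorphism.Build bdseq aseq germ germ_is_monoid_morphism.

Lemma germM x y : germ (x * y) = germ x * germ y.
Proof. exact: rmorphM. Qed.

Lemma germ_sum (I : Type) (r : seq I) (P : pred I) (f : I -> bdseq) :
  germ (\sum_(i <- r | P i) f i) = \sum_(i <- r | P i) germ (f i).
Proof. exact: rmorph_sum. Qed.

Definition aseq_star (q : aseq) : aseq := germ (star_seq (repr q)).

(** The adjoint of a class can be computed on any representative, as the
    involution is isometric. *)
Lemma star_germ x : aseq_star (germ x) = germ (star_seq x).
Proof.
have /asboolP hr : repr (germ x) - x \in null_seq by apply/germ_eq; rewrite germ_repr.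
apply/germ_eq/asboolP => e /hr [N0 h]; exists N0 => N /h.
by rewrite -[X in X < _ -> _]cnorm_star starB.
Qed.

Fact aseq_starD : {morph aseq_star : p q / p + q}.
Proof.
move=> p q; case: (germP p) (germP q) => x -> [y ->].
rewrite -raddfD !star_germ -raddfD; congr germ; apply: val_inj.
by apply/funext => N; exact: starD.
Qed.

Fact aseq_starM p q : aseq_star (p * q) = aseq_star q * aseq_star p.
Proof.
case: (germP p) (germP q) => x -> [y ->].
rewrite -rmorphM !star_germ -rmorphM; congr germ; apply: val_inj.
by apply/funext => N; exact: starM.
Qed.

Lemma bdseq_sumE (I : Type) (r : seq I) (P : pred I) (F : I -> bdseq) N :
  (\sum_(i <- r | P i) F i) N = \sum_(i <- r | P i) F i N.
Proof. by elim/big_rec2: _ => // i y1 y2 _ <-. Qed.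

End BoundedSequences.

(** * Compression of a matrix by commuting matrix units *)

Record matrix_units (R : realType) (J : finType) (F : frame R J)
    (T : pzRingType) (st : T -> T) (E : pt F -> pt F -> T) : Prop := {
  unitsM : forall x y z w, cls x = cls y -> cls z = cls w ->
    E x y * E z w = (y == z)%:R * E x w;
  units1 : \sum_x E x x = 1;
  units_star : forall x y, cls x = cls y -> st (E x y) = E y x
}.

Section Compression.
Variables (R : realType) (J : finType) (F : frame R J) (T : pzRingType).
Variables (st : T -> T) (E : pt F -> pt F -> T) (a : J -> J -> T) (o : J).
Hypothesis stD : {morph st : x y / x + y}.
Hypothesis stM : forall x y, st (x * y) = st y * st x.
Hypothesis E_units : matrix_units st E.
Hypothesis a_comm : forall i j x y, GRing.comm (a i j) (E x y).

(** With e the projection onto the chosen points [emb c o], one for each block,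
    the elements [corner_row j] are partial isometries from the [j]-th chosen
    points onto the range of e; [compression] is the copy of the matrix [a]
    carried by the chosen points. *)
Definition corner_row (j : J) : T := \sum_c E (emb c o) (emb c j).
Definition compression : T :=
  \sum_j \sum_k st (corner_row j) * a j k * corner_row k.
Definition column_unit (s : pt F) (j : J) : T := E (emb (cls s) j) s.

Local Notation x_ := corner_row.

Let st0 : st 0 = 0.
Proof. by apply: (addIr (st 0)); rewrite -stD !add0r. Qed.

Let st_sum (I : Type) (r : seq I) (P : pred I) (f : I -> T) :
  st (\sum_(i <- r | P i) f i) = \sum_(i <- r | P i) st (f i).
Proof. exact: (big_morph st stD st0). Qed.

Let emb_eq c d i j : (emb c i == emb d j :> pt F) = (c == d) && (i == j).
Proof.
have [->|cd] /= := eqVneq c d; first by rewrite (inj_eq (@emb_inj _ _ _ _)).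
by apply/negbTE/eqP => /(congr1 (@cls _ _ _)); rewrite !cls_emb => /eqP; rewrite (negbTE cd).
Qed.

Lemma st_corner_row j : st (x_ j) = \sum_c E (emb c j) (emb c o).
Proof.
by rewrite st_sum; apply: eq_bigr => c _; rewrite (units_star E_units) ?cls_emb.
Qed.

Let mul_sums (k : J) z w : cls z = cls w ->
  (\sum_d E (emb d o) (emb d k)) * E z w
  = (z == emb (cls z) k)%:R * E (emb (cls z) o) w.
Proof.
move=> zw; rewrite mulr_suml (bigD1 (cls z)) //= big1 ?addr0 => [|d dz].
  by rewrite (unitsM E_units) ?cls_emb // eq_sym.
rewrite (unitsM E_units) ?cls_emb //; case: eqP => [e|]; last by rewrite mul0r.
by move: dz; rewrite -e cls_emb eqxx.
Qed.

Lemma corner_row_mul_st j k : x_ j * st (x_ k) = (j == k)%:R * x_ o.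
Proof.
rewrite st_corner_row mulr_sumr mulr_sumr; apply: eq_bigr => c _.
rewrite mul_sums; last by rewrite !cls_emb.
by rewrite cls_emb emb_eq eqxx eq_sym.
Qed.

Lemma corner_rowK k : x_ o * x_ k = x_ k.
Proof.
rewrite {2 3}/corner_row mulr_sumr; apply: eq_bigr => c _.
rewrite mul_sums; last by rewrite !cls_emb.
by rewrite cls_emb eqxx mul1r.
Qed.

Lemma corner_row_column k s j :
  x_ k * column_unit s j = (k == j)%:R * E (emb (cls s) o) s.
Proof.
rewrite mul_sums; last by rewrite cls_emb.
by rewrite cls_emb emb_eq eqxx eq_sym.
Qed.

Lemma comm_corner_row i j k : GRing.comm (a i j) (x_ k).
Proof. by apply: commr_sum => c _; exact: a_comm. Qed.

Let y_ j := \sum_k a j k * x_ k.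

Let compressionE : compression = \sum_j st (x_ j) * y_ j.
Proof.
apply: eq_bigr => j _; rewrite mulr_sumr; apply: eq_bigr => k _.
by rewrite mulrA.
Qed.

(** The norm of the compression is that of [a] applied to the column of the
    [corner_row k], because the projection e that appears between the two
    factors commutes with [a] and is absorbed by these elements. *)
Lemma compression_star_mul :
  st compression * compression
  = \sum_j st (\sum_k a j k * x_ k) * (\sum_k a j k * x_ k).
Proof.
have xy j : x_ o * y_ j = y_ j.
  rewrite mulr_sumr; apply: eq_bigr => k _.
  by rewrite mulrA -comm_corner_row -mulrA corner_rowK.
have stst j : st (st (x_ j)) = x_ j.
  rewrite st_corner_row st_sum; apply: eq_bigr => c _.
  by rewrite (units_star E_units) ?cls_emb.
rewrite compressionE st_sum mulr_suml; apply: eq_bigr => j _.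
rewrite stM stst mulr_sumr (bigD1 j) //= big1 ?addr0 => [|k kj].
  by rewrite -mulrA (mulrA (x_ j)) corner_row_mul_st eqxx mul1r xy.
by rewrite -mulrA (mulrA (x_ j)) corner_row_mul_st eq_sym (negbTE kj) !mul0r mulr0.
Qed.

(** [p] is the square modulus of the column of the [corner_row k], so this
    column has norm at most 1. *)
Lemma corner_rows_proj (p := \sum_k st (x_ k) * x_ k) : st p * p = p.
Proof.
have -> : st p = p.
  rewrite st_sum; apply: eq_bigr => k _; rewrite stM; congr (_ * _).
  rewrite st_corner_row st_sum; apply: eq_bigr => c _.
  by rewrite (units_star E_units) ?cls_emb.
rewrite {1}/p mulr_suml; apply: eq_bigr => k _.
rewrite mulr_sumr (bigD1 k) //= big1 ?addr0 => [|j jk].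
  by rewrite -mulrA (mulrA (x_ k)) corner_row_mul_st eqxx mul1r corner_rowK.
by rewrite -mulrA (mulrA (x_ k)) corner_row_mul_st eq_sym (negbTE jk) !mul0r mulr0.
Qed.

(** Moving the point s to the chosen points, applying the compression and moving
    back gives a i j on the range of E s s; these projections add up to 1. *)
Lemma entry_from_compression i j :
  a i j = \sum_s st (column_unit s i) * compression * column_unit s j.
Proof.
have term s : st (column_unit s i) * compression * column_unit s j = a i j * E s s.
  rewrite compressionE mulr_sumr mulr_suml (bigD1 i) //= big1 ?addr0 => [|k ki].
    rewrite mulrA -stM corner_row_column eqxx mul1r -mulrA mulr_suml.
    rewrite (bigD1 j) //= big1 ?addr0 => [|k kj]; rewrite -mulrA corner_row_column.
      rewrite eqxx mul1r (units_star E_units) ?cls_emb // mulrA.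
      by rewrite -a_comm -mulrA (unitsM E_units) ?cls_emb // eqxx mul1r.
    by rewrite (negbTE kj) mul0r mulr0.
  by rewrite mulrA -stM corner_row_column (negbTE ki) mul0r st0 !mul0r.
by under eq_bigr => s _ do rewrite term; rewrite -mulr_sumr (units1 E_units) mulr1.
Qed.

End Compression.

Lemma comm_mulrACA (T : pzRingType) (a b c d : T) :
  GRing.comm b c -> a * b * (c * d) = a * c * (b * d).
Proof. by move=> bc; rewrite mulrA -(mulrA a) bc !mulrA. Qed.

(** * Asymptotically central matrix units *)

Section Realizable.
Variables (R : realType) (A : cstarAlgType R).

Lemma bdseq_scaleE (c : R[i]) (x : bdseq A) N : (c *: x) N = c *: x N.
Proof. by []. Qed.

Lemma bdseq_mulE (x y : bdseq A) N : (x * y) N = x N * y N.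
Proof. by []. Qed.

Lemma bdseqP (x y : bdseq A) : (forall N, x N = y N) -> x = y.
Proof. by move=> xy; apply: val_inj; apply/funext. Qed.

Lemma germZ_eq (c : R[i]) (x y : bdseq A) : germ x = germ y ->
  germ (c *: x) = germ (c *: y).
Proof. by move=> /germ_eq h; apply/germ_eq; rewrite -scalerBr null_seqZ. Qed.

Lemma comm_germZ (q : aseq A) (c : R[i]) (x : bdseq A) :
  GRing.comm q (germ x) -> GRing.comm q (germ (c *: x)).
Proof.
rewrite -(germ_repr q); move: (repr q) => y h.
have e1 : y * (c *: x) = c *: (y * x) by apply: bdseqP => N; exact: esym (scalerAr _ _ _).
have e2 : (c *: x) * y = c *: (x * y) by apply: bdseqP => N; exact: esym (scalerAl _ _ _).
rewrite /GRing.comm -!rmorphM e1 e2; apply: germZ_eq.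
by rewrite !rmorphM.
Qed.

Lemma comm_frame_unit (J : finType) (F : frame R J) (u : gen F -> bdseq A) q x y :
  (forall g, GRing.comm q (germ (u g))) -> GRing.comm q (germ (frame_unit u x y)).
Proof.
by move=> h; rewrite raddf_sum; apply: commr_sum => g _; exact: comm_germZ.
Qed.

(** A frame is realizable when its unitaries can be found in A, asymptotically
    commuting with any finite list of sequences.  Allowing the list to contain
    arbitrary sequences, and not just elements of A, is what makes the notion
    stable under tensor products: unitaries already found may be put in it. *)
Definition realizable (J : finType) (F : frame R J) : Prop :=
  forall L : seq (aseq A), exists u : gen F -> bdseq A,
    [/\ forall g N, cnorm (u g N) <= 1,
        forall q g, q \in L -> GRing.comm q (germ (u g))
      & matrix_units (@aseq_star R A) (fun x y => germ (frame_unit u x y))].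

End Realizable.

(** Blocks and points are pairs, and the unitaries are the products of
    commuting unitaries of the two factors. *)
Section TensorFrame.
Variables (R : realType) (J J' : finType) (F : frame R J) (F' : frame R J').

Fact tensor_cls_emb (c : cl F * cl F') (j : J * J') :
  (cls (emb c.1 j.1), cls (emb c.2 j.2)) = c.
Proof. by rewrite !cls_emb; case: c. Qed.

Fact tensor_emb_inj (c : cl F * cl F') :
  injective (fun j : J * J' => (emb c.1 j.1, emb c.2 j.2)).
Proof. by move=> [j j'] [k k'] [] /emb_inj /= -> /emb_inj ->. Qed.

Fact tensor_gen_gt0 : (0 < #|{: gen F * gen F'}|)%N.
Proof. by rewrite card_prod muln_gt0 !gen_gt0. Qed.

Fact tensor_coef_orth (x y z w : pt F * pt F') :
  (cls x.1, cls x.2) = (cls y.1, cls y.2) ->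
  (cls z.1, cls z.2) = (cls w.1, cls w.2) ->
  \sum_(g : gen F * gen F')
     coef x.1 y.1 g.1 * coef x.2 y.2 g.2 * (coef z.1 w.1 g.1 * coef z.2 w.2 g.2)
  = ((x, y) == (z, w))%:R *
    (#|[pred t : pt F * pt F' | (cls t.1, cls t.2) == (cls x.1, cls x.2)]|%:R
      / #|{: gen F * gen F'}|%:R) :> R.
Proof.
move=> [e1 e2] [e3 e4].
under eq_bigr => g _ do rewrite mulrACA.
rewrite -(pair_bigA _ (fun g g' => (coef x.1 y.1 g * coef z.1 w.1 g)
  * (coef x.2 y.2 g' * coef z.2 w.2 g'))) /=.
under eq_bigr => g _ do rewrite -mulr_sumr.
rewrite -mulr_suml !coef_orth // mulrACA -natrM mulnb mulrACA -invfM -!natrM.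
rewrite card_prod -cardX; congr (_%:R * (_%:R / _)).
by move: x y z w {e1 e2 e3 e4} => [? ?] [? ?] [? ?] [? ?] /=; rewrite !xpair_eqE andbACA.
Qed.

Definition tensor_frame : frame R (J * J')%type :=
  Frame tensor_cls_emb tensor_emb_inj tensor_gen_gt0 tensor_coef_orth.

Lemma realizable_tensor (A : cstarAlgType R) :
  realizable A F -> realizable A F' -> realizable A tensor_frame.
Proof.
move=> hF hF' L.
have [u [u1 uL uE]] := hF L.
have [u' [u1' uL' uE']] := hF' (L ++ codom (fun g => germ (u g))).
pose v (g : gen tensor_frame) := u g.1 * u' g.2.
have vE x y : frame_unit v x y = frame_unit u x.1 y.1 * frame_unit u' x.2 y.2.
  apply: bdseqP => N; rewrite bdseq_mulE /frame_unit !bdseq_sumE mulr_suml.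
  rewrite -(pair_bigA _ (fun g g' => (coef x.1 y.1 g * coef x.2 y.2 g')
     ** (u g N * u' g' N))) /=.
  apply: eq_bigr => g _; rewrite mulr_sumr; apply: eq_bigr => g' _.
  by rewrite -scalerAl -scalerAr scalerA rmorphM.
have cE x y x' y' : GRing.comm (germ (frame_unit u x y)) (germ (frame_unit u' x' y')).
  apply: comm_frame_unit => g'; apply: commr_sym; apply: comm_frame_unit => g.
  by apply: commr_sym; apply: uL'; rewrite mem_cat (codom_f (fun g => germ (u g))) orbT.
exists v; split=> [g N|q g qL|].
- apply: le_trans (cnormM _ _) _; rewrite -[X in _ <= X]mulr1.
  by apply: ler_pM; rewrite ?cnorm_ge0 ?u1 ?u1'.
- rewrite rmorphM; apply: commrM; [exact: uL|apply: uL'].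
  by rewrite mem_cat qL.
have /= uM := unitsM uE; have /= uM' := unitsM uE'.
have /= us := units_star uE; have /= us' := units_star uE'.
split=> [x y z w [e1 e2] [e3 e4]||x y [e1 e2]].
- rewrite !vE !rmorphM comm_mulrACA; last exact/commr_sym/cE.
  rewrite uM // uM' //.
  rewrite !mulr_natl mulrnAr mulrnAl -mulrnA mulnb.
  by move: y z {e1 e2 e3 e4} => [? ?] [? ?]; rewrite xpair_eqE andbC.
- under eq_bigr => x _ do rewrite vE rmorphM.
  rewrite -(pair_bigA _ (fun x x' =>
    germ (frame_unit u x x) * germ (frame_unit u' x' x'))) /=.
  under eq_bigr => x _ do rewrite -mulr_sumr (units1 uE') mulr1.
  exact: units1 uE.
- by rewrite !vE !rmorphM aseq_starM us // us' // cE.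
Qed.

End TensorFrame.

(** Dropping chosen points makes powers of 2 suffice for all matrix sizes. *)
Section RestrictFrame.
Variables (R : realType) (J J' : finType) (F : frame R J) (h : J' -> J).
Hypothesis h_inj : injective h.

Definition restrict_frame : frame R J' :=
  @Frame R J' (pt F) (cl F) (gen F) (@cls _ _ F) (fun c j => emb c (h j))
    (@coef _ _ F) (fun c j => cls_emb c (h j))
    (fun c => inj_comp (@emb_inj _ _ F c) h_inj) (gen_gt0 F) (@coef_orth _ _ F).

Lemma realizable_restrict (A : cstarAlgType R) :
  realizable A F -> realizable A restrict_frame.
Proof.
move=> hF L; have [u [u1 uL [uM uI us]]] := hF L.
by exists u; split=> //; split.
Qed.

End RestrictFrame.

(** The scalars, as a first step for iterated tensor products. *)
Section TrivialFrame.
Variable R : realType.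

Fact trivial_coef_orth (x y z w : unit) : tt = tt -> tt = tt ->
  \sum_(g : unit) (1 : R) * 1
  = ((x, y) == (z, w))%:R * (#|[pred t : unit | tt == tt]|%:R / #|{: unit}|%:R).
Proof.
move=> _ _; case: x y z w => [] [] [] []; rewrite eqxx mul1r sumr_const card_unit.
by rewrite divr1 mulr1.
Qed.

Definition trivial_frame : frame R unit :=
  @Frame R unit unit unit unit (fun=> tt) (fun _ _ => tt) (fun _ _ _ => 1)
    (fun c _ => let: tt := c in erefl)
    (fun _ x y _ => let: tt := x in let: tt := y in erefl)
    (eq_leq (esym card_unit)) trivial_coef_orth.

Lemma realizable_trivial (A : cstarAlgType R) : realizable A trivial_frame.
Proof.
move=> L; exists (fun=> 1).
have E1 x y : frame_unit (F := trivial_frame) (fun=> 1 : bdseq A) x y = 1.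
  apply: bdseqP => N; rewrite /frame_unit bdseq_sumE (big_pred1 tt) => [|[]//].
  by rewrite bdseq_scaleE scale1r.
split=> [g N|q g _|].
- by rewrite [X in cnorm X](_ : _ = 1) // cnorm1.
- by rewrite rmorph1; exact: commr1.
split=> [x y z w _ _||x y _]; rewrite ?E1.
- by case: y z => [] []; rewrite eqxx rmorph1 !mulr1.
- by rewrite (big_pred1 tt) => [|[]//]; rewrite E1 rmorph1.
- by rewrite rmorph1 star_germ -[RHS](rmorph1 (@germ R A)); congr germ;
    apply: bdseqP => N; exact: star1.
Qed.

End TrivialFrame.

(** * The frame of M_2 + M_3 *)

(** The unitaries are the products of a diagonal matrix of signs, one sign for
    each of the 2 + 3 points, and of cyclic permutations of the two blocks.
    Averaging against the sign of y isolates the column y, and summing over the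
    permutations that send y to x isolates the row x.  Independent signs and
    independent permutations in the two blocks separate the blocks. *)
Section BaseFrame.
Variable R : realType.

Notation block_point := ('I_2 + 'I_3)%type.
Notation shift_sign := (('I_2 * 'I_3) * {ffun block_point -> bool})%type.

Definition base_cls (x : block_point) : bool := if x is inr _ then true else false.

Definition base_emb (c j : bool) : block_point :=
  if c then inr (if j then ord_max else ord0)
  else inl (if j then ord_max else ord0).

Definition translate (t : 'I_2 * 'I_3) (x : block_point) : block_point :=
  match x with inl a => inl (a + t.1) | inr a => inr (a + t.2) end.

Definition csign (e : {ffun block_point -> bool}) (x : block_point) : R := (-1) ^+ e x.

Definition base_size (x : block_point) : R :=
  #|[pred t | base_cls t == base_cls x]|%:R.

Definition base_coef (x y : block_point) (g : shift_sign) : R :=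
  base_size x / #|{: shift_sign}|%:R * (translate g.1 y == x)%:R * csign g.2 y.

(** For distinct points, changing the sign at [x] is an involution of the index
    set that negates every term. *)
Lemma sum_csign (x y : block_point) :
  \sum_e csign e x * csign e y = (x == y)%:R * #|{: {ffun block_point -> bool}}|%:R.
Proof.
have [->|xy] := eqVneq x y.
  rewrite mul1r -sumr_const; apply: eq_bigr => e _.
  by rewrite -expr2 sqrr_sign.
rewrite mul0r.
pose flip (e : {ffun block_point -> bool}) := [ffun z => e z (+) (z == x)].
have flipK : involutive flip.
  by move=> e; apply/ffunP => z; rewrite !ffunE addbK.
set S := LHS; suff : S = - S by move=> h; lra.
rewrite {1}/S (reindex_inj (inv_inj flipK)) -sumrN; apply: eq_bigr => e _.
rewrite /csign !ffunE eqxx (eq_sym y) (negbTE xy) addbF addbT.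
by rewrite signrN mulNr.
Qed.

(** 6 is the number of pairs of cyclic permutations: prescribing the image of a
    point of a block of size k leaves 6 / k of them. *)
Lemma card_shift_onto (x y : block_point) : base_cls x = base_cls y ->
  (\sum_t (translate t y == x)%:R) * base_size x = 6 :> R.
Proof.
have sizeE : base_size x = (if x is inr _ then 3 else 2).
  rewrite /base_size -sum1_card natr_sum big_mkcond big_sumType /=.
  by case: x => ? /=; rewrite ?big1_eq !sumr_const !card_ord /=; lra.
rewrite -(pair_bigA _ (fun a b => (translate (a, b) y == x)%:R)) sizeE /=.
have one n (a b : 'I_n.+1) : \sum_i (a + i == b)%:R = 1 :> R.
  rewrite (bigD1 (b - a)) //= [a + (b - a)]addrC subrK eqxx big1 ?addr0 // => i /negbTE ni.
  by rewrite [a + i]addrC eq_sym -subr_eq eq_sym ni.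
case: x y {sizeE} => a [] b // _ /=; last first.
  under eq_bigr => i _ do rewrite one.
  by rewrite sumr_const card_ord; lra.
rewrite exchange_big; under eq_bigr => i _ do rewrite one.
by rewrite sumr_const card_ord; lra.
Qed.

Lemma card_shift_sign :
  #|{: shift_sign}|%:R = 6 * #|{: {ffun block_point -> bool}}|%:R :> R.
Proof. by rewrite !card_prod !card_ord natrM. Qed.

Lemma card_ffun_gt0 : 0 < #|{: {ffun block_point -> bool}}|%:R :> R.
Proof. by rewrite ltr0n; apply/card_gt0P; exists [ffun=> true]. Qed.

Fact base_cls_emb c j : base_cls (base_emb c j) = c.
Proof. by case: c. Qed.

Fact base_emb_inj c : injective (base_emb c).
Proof. by case: c => [] [] [] //= []. Qed.

Fact shift_sign_gt0 : (0 < #|{: shift_sign}|)%N.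
Proof. by rewrite -(ltr0n R) card_shift_sign mulr_gt0 ?card_ffun_gt0. Qed.

Fact base_coef_orth x y z w : base_cls x = base_cls y -> base_cls z = base_cls w ->
  \sum_g base_coef x y g * base_coef z w g
  = ((x, y) == (z, w))%:R *
    (#|[pred t | base_cls t == base_cls x]|%:R / #|{: shift_sign}|%:R).
Proof.
move=> xy zw; set N : R := #|{: shift_sign}|%:R.
rewrite (eq_bigr (fun g => base_size x / N * (base_size z / N) *
   (((translate g.1 y == x)%:R * (translate g.1 w == z)%:R) * (csign g.2 y * csign g.2 w))));
  last by move=> g _; rewrite /base_coef -/N; ring.
rewrite -mulr_sumr -(pair_bigA _ (fun t e =>
   ((translate t y == x)%:R * (translate t w == z)%:R) * (csign e y * csign e w))) /=.
under eq_bigr => t _ do rewrite -mulr_sumr sum_csign.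
rewrite -mulr_suml xpair_eqE; have [<-|yw] := eqVneq y w; last first.
  by rewrite mul0r !mulr0 andbF mul0r.
rewrite mul1r andbT; have [<-|xz] := eqVneq x z; last first.
  rewrite big1 ?mul0r ?mulr0 // => t _.
  by have [->|] := eqVneq (translate t y) x; rewrite ?mul0r // (negbTE xz) mulr0.
under eq_bigr => t _ do rewrite -natrM mulnb andbb.
have Npos : N != 0 by rewrite /N pnatr_eq0 -lt0n shift_sign_gt0.
have := card_shift_onto xy; have := card_shift_sign; rewrite -/N -/(base_size x).
set P := #|{: {ffun _}}|%:R; set S := \sum_t _; set k := base_size x => eN eS.
have : k * S * P = N by rewrite eN -eS (mulrC k).
move=> h; rewrite mul1r.
have -> : k / N * (k / N) * (S * P) = k / N * (k * S * P) / N by ring.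
by rewrite h mulfK.
Qed.

Definition base_frame : frame R bool :=
  Frame base_cls_emb base_emb_inj shift_sign_gt0 base_coef_orth.

End BaseFrame.

(** * M_2 + M_3 in a matrix algebra *)

Section MatrixAlgebra.
Variable R : realType.
Local Notation bpt := (pt (base_frame R)).

Definition adjmx (n : nat) (M : 'M[R[i]]_n) : 'M[R[i]]_n :=
  map_mx (@Num.conj R[i]) M^T.

Lemma adjmx_delta n (i j : 'I_n) : adjmx (delta_mx i j) = delta_mx j i.
Proof.
by apply/matrixP => a b; rewrite !mxE conjC_nat andbC.
Qed.

Lemma adjmx0 n : adjmx (0 : 'M[R[i]]_n) = 0.
Proof. by apply/matrixP => a b; rewrite !mxE conjC0. Qed.

Definition units2 (x y : bpt) : 'M[R[i]]_2 :=
  match x, y with inl a, inl b => delta_mx a b | _, _ => 0 end.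

Definition units3 (x y : bpt) : 'M[R[i]]_3 :=
  match x, y with inr a, inr b => delta_mx a b | _, _ => 0 end.

Lemma matrix_units2 : matrix_units (@adjmx 2) units2.
Proof.
split.
- move=> [x|x] [y|y] [z|z] [w|w] //= _ _; rewrite ?mul0r ?mulr0 //.
  by rewrite mulr_natl -mulmxE mul_delta_mx_cond.
- rewrite big_sumType /= [X in _ + X]big1 // addr0; exact: esym (mx1_sum_delta _ _).
- move=> [x|x] [y|y] //= _; [exact: adjmx_delta|exact: adjmx0].
Qed.

Lemma matrix_units3 : matrix_units (@adjmx 3) units3.
Proof.
split.
- move=> [x|x] [y|y] [z|z] [w|w] //= _ _; rewrite ?mul0r ?mulr0 //.
  by rewrite mulr_natl -mulmxE mul_delta_mx_cond.
- rewrite big_sumType /= big1 // add0r; exact: esym (mx1_sum_delta _ _).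
- move=> [x|x] [y|y] //= _; [exact: adjmx0|exact: adjmx_delta].
Qed.

Lemma matrix_units_block m n (E : bpt -> bpt -> 'M[R[i]]_m)
    (E' : bpt -> bpt -> 'M[R[i]]_n) :
  matrix_units (@adjmx m) E -> matrix_units (@adjmx n) E' ->
  matrix_units (@adjmx (m + n)) (fun x y => block_mx (E x y) 0 0 (E' x y)).
Proof.
move=> [EM E1 Es] [EM' E1' Es']; split.
- move=> x y z w xy zw; rewrite -mulmxE mulmx_block !mulmx0 !mul0mx !addr0 !add0r.
  rewrite !mulmxE EM // EM' // !mulr_natl; case: eqP => _; rewrite ?mulr1n //.
  by rewrite !mulr0n block_mx0.
- have -> : \sum_x block_mx (E x x) 0 0 (E' x x)
      = block_mx (\sum_x E x x) 0 0 (\sum_x E' x x).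
    elim/big_rec3: _ => [|x M N P _ ->]; first by rewrite block_mx0.
    by rewrite add_block_mx !addr0.
  by rewrite E1 E1'; exact: esym (scalar_mx_block _ _ _).
- move=> x y xy; have := Es' _ _ xy; have := Es _ _ xy; rewrite /adjmx => <- <-.
  by rewrite tr_block_mx map_block_mx !trmx0 !map_mx0.
Qed.

(** Cut the n rows into groups of 2, and one group of 3 when n is odd.  If n is
    even the matrix units of M_3 are sent to 0, and so are those of M_2 if
    n = 3; the relations allow this, because they only ask that all diagonal
    matrix units together add up to 1. *)
Lemma exists_matrix_units n : (2 <= n)%N ->
  exists E : bpt -> bpt -> 'M[R[i]]_n, matrix_units (@adjmx n) E.
Proof.
elim/ltn_ind: n => [] [|[|[|[|n]]]] IH // _.
- by exists units2; exact: matrix_units2.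
- by exists units3; exact: matrix_units3.
- have [E hE] := IH n.+2 (ltnW (ltnSn _)) isT.
  by exists (fun x y => block_mx (units2 x y) 0 0 (E x y));
    exact: (matrix_units_block matrix_units2 hE).
Qed.

End MatrixAlgebra.

(** * Matrix units from approximate divisibility *)

Lemma leq_bigmin (I : eqType) (r : seq I) (F : I -> nat) (a : nat) (j : I) :
  j \in r -> (\big[minn/a]_(i <- r) F i <= F j)%N.
Proof.
elim: r => // i r IH; rewrite inE big_cons => /orP[/eqP<-|/IH h].
  exact: geq_minl.
exact: leq_trans (geq_minr _ _) h.
Qed.

Section StarIso.
Variables (R : realType) (A : cstarAlgType R).
Local Notation bpt := (pt (base_frame R)).
Variables (r : nat) (k : 'I_r -> nat).
Variables (phi : (forall i, 'M[R[i]]_(k i)) -> A) (B : set A).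
Hypothesis iso : is_star_iso phi B.

Lemma star_iso_sum (I : Type) (s : seq I) (F : I -> forall i, 'M[R[i]]_(k i)) :
  phi (fun i => \sum_(x <- s) F x i) = \sum_(x <- s) phi (F x).
Proof.
elim: s => [|x s IH].
  transitivity (phi (fun i => 0 *: (0 : 'M[R[i]]_(k i)))).
    by congr phi; apply: functional_extensionality_dep => i; rewrite big_nil scaler0.
  by rewrite (star_isoZ iso 0 (fun i => 0)) scale0r big_nil.
rewrite big_cons -IH -(star_isoD iso); congr phi.
by apply: functional_extensionality_dep => i; rewrite big_cons.
Qed.

Lemma star_iso1 : B 1 -> phi (fun i => 1%:M) = 1.
Proof.
rewrite -(star_iso_onto iso) => -[z _ z1].
rewrite -[LHS]mulr1 -z1 -(star_isoM iso); congr phi.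
by apply: functional_extensionality_dep => i; rewrite mul1mx.
Qed.

Lemma star_iso_units (E : forall i, bpt -> bpt -> 'M[R[i]]_(k i)) : B 1 ->
  (forall i, matrix_units (@adjmx R (k i)) (E i)) ->
  matrix_units (@star R A) (fun x y => phi (fun i => E i x y)).
Proof.
move=> B1 hE; split.
- move=> x y z w xy zw; rewrite -(star_isoM iso) mulr_natl -scaler_nat.
  rewrite -(star_isoZ iso); congr phi; apply: functional_extensionality_dep => i.
  by rewrite mulmxE (unitsM (hE i)) // mulr_natl scaler_nat.
- rewrite -star_iso_sum -(star_iso1 B1); congr phi.
  by apply: functional_extensionality_dep => i; exact: units1 (hE i).
- move=> x y xy; rewrite -(star_iso_star iso); congr phi.
  by apply: functional_extensionality_dep => i; exact: units_star (hE i) _ _ xy.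
Qed.

End StarIso.

Lemma subrank_units (R : realType) (A : cstarAlgType R) (B : set A) (m : nat) :
  is_subrank B m -> (2 <= m)%N -> B 1 ->
  exists E : pt (base_frame R) -> pt (base_frame R) -> A,
    matrix_units (@star R A) E /\ (forall x y, B (E x y)).
Proof.
move=> [r [k [phi [_ iso mE]]]] m2 B1.
have k2 i : (2 <= k i)%N.
  apply: leq_trans m2 _; rewrite mE.
  by apply: leq_bigmin; rewrite mem_index_enum.
pose E i := projT1 (cid (exists_matrix_units R (k2 i))).
have hE i : matrix_units (@adjmx R (k i)) (E i).
  exact: projT2 (cid (exists_matrix_units R (k2 i))).
exists (fun x y => phi (fun i => E i x y)); split.
  exact: (star_iso_units iso B1 hE).
by move=> x y; rewrite -(star_iso_onto iso); exists (fun i => E i x y).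
Qed.

Section ShiftSigns.
Variables (R : realType) (A : cstarAlgType R).
Local Notation base := (base_frame R).
Variable E : pt base -> pt base -> A.
Hypothesis E_units : matrix_units (@star R A) E.

Definition shift_sign_unitary (g : gen base) : A :=
  \sum_(y : pt base) csign R g.2 y ** E (translate g.1 y) y.

Lemma cls_translate t (y : pt base) : cls (translate t y : pt base) = cls y.
Proof. by case: y. Qed.

Lemma translate_inj t : injective (translate t).
Proof.
by apply: (can_inj (g := translate (- t))) => -[x|x] /=; rewrite addrK.
Qed.

Lemma csign_sqr e (y : pt base) : csign R e y * csign R e y = 1.
Proof. by rewrite -expr2 sqrr_sign. Qed.

Lemma shift_sign_unitary_le1 g : cnorm (shift_sign_unitary g) <= 1.
Proof.
suff : cnorm (shift_sign_unitary g) ^+ 2 = 1.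
  by move=> h; rewrite -(@expr_le1 _ 2) ?h // cnorm_ge0.
rewrite -cnorm_starM -[RHS](cnorm1 A) -(units1 E_units); congr cnorm.
rewrite /shift_sign_unitary star_sum mulr_suml; apply: eq_bigr => y _.
rewrite mulr_sumr (bigD1 y) //= big1 ?addr0 => [|z zy].
  rewrite starZr (units_star E_units) ?cls_translate //.
  rewrite -scalerAl -scalerAr scalerA -rmorphM csign_sqr rmorph1 scale1r.
  by rewrite (unitsM E_units) ?cls_translate // eqxx mul1r.
rewrite starZr (units_star E_units) ?cls_translate //.
rewrite -scalerAl -scalerAr (unitsM E_units) ?cls_translate //.
by rewrite (inj_eq (@translate_inj _)) eq_sym (negbTE zy) mul0r !scaler0.
Qed.

(** Orthogonality of the signs isolates the column y, and [card_shift_onto]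
    counts the permutations that send y to x. *)
Lemma units_from_shift_signs (x y : pt base) : cls x = cls y ->
  \sum_g coef x y g ** shift_sign_unitary g = E x y.
Proof.
move=> xy; pose N : R := #|{: gen base}|%:R.
pose M : R := #|{: {ffun pt base -> bool}}|%:R.
have sum_sign (z w : pt base) : \sum_e csign R e z * csign R e w = (z == w)%:R * M.
  exact: sum_csign.
have key t : \sum_e coef x y (t, e) ** shift_sign_unitary (t, e)
    = (base_size R x / N * M * (translate t y == x)%:R) ** E x y.
  transitivity (\sum_(z : pt base)
     (\sum_e (csign R e y * csign R e z)) **
       ((base_size R x / N * (translate t y == x)%:R) ** E (translate t z) z)).
    under eq_bigr => e _ do rewrite scaler_sumr.
    rewrite exchange_big /=; apply: eq_bigr => z _.
    rewrite rmorph_sum scaler_suml; apply: eq_bigr => e _.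
    rewrite !scalerA -!rmorphM; congr ((_%:C)%C *: _).
    by rewrite /base_coef -/N /=; ring.
  rewrite (bigD1 y) //= [X in _ + X]big1 ?addr0 => [|z zy]; last first.
    by rewrite sum_sign eq_sym (negbTE zy) mul0r rmorph0 scale0r.
  rewrite sum_sign eqxx mul1r scalerA -rmorphM.
  have [->|_] := eqVneq (translate t y) x; last by rewrite !mulr0 !rmorph0 !scale0r.
  by congr ((_%:C)%C *: _); ring.
rewrite -(pair_bigA _ (fun t e => coef x y (t, e) ** shift_sign_unitary (t, e))) /=.
under eq_bigr => t _ do rewrite key.
rewrite -scaler_suml -rmorph_sum -mulr_sumr.
have N0 : N != 0 by rewrite pnatr_eq0 -lt0n gen_gt0.
rewrite (_ : _ * _ = 1) ?rmorph1 ?scale1r //.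
have := card_shift_onto R xy; have := card_shift_sign R.
rewrite -/N -/M; set S := \sum_t _ => NE SE.
have -> : base_size R x / N * M * S = (S * base_size R x) * M / N by ring.
by rewrite SE -NE divff.
Qed.

End ShiftSigns.

(** The unitaries at index N come from a subalgebra that commutes up to
    1 / (N + 1) with the N-th terms of the given sequences, while the relations
    between matrix units hold exactly at every index. *)
Lemma realizable_base (R : realType) (A : cstarAlgType R) :
  approximately_divisible A -> realizable A (base_frame R).
Proof.
move=> apx L; pose l (i : 'I_(size L)) := repr (tnth (in_tuple L) i).
have step (N : nat) : exists E : pt (base_frame R) -> pt (base_frame R) -> A,
   matrix_units (@star R A) E /\
   forall i g, cnorm (l i N * shift_sign_unitary E g
       - shift_sign_unitary E g * l i N) < N.+1%:R^-1.
  have [|B [subB _ B1 [m sub m2] commB]] := apx _ (fun i => l i N) N.+1%:R^-1.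
    by rewrite invr_gt0.
  have [E [hE BE]] := subrank_units sub m2 B1.
  exists E; split=> // i g; apply: commB; last exact: shift_sign_unitary_le1.
  rewrite /shift_sign_unitary; apply: (big_ind B) => [||y _].
  - exact: cstar_sub0 subB.
  - exact: cstar_subD subB.
  - exact: (cstar_subZ subB).
have [E hE] := choice step.
have uP g : bounded_seq (fun N => shift_sign_unitary (E N) g).
  by apply/asboolP; exists 1 => N; apply: shift_sign_unitary_le1 (proj1 (hE N)) _.
pose u g : bdseq A := BdSeq (uP g).
have uE x y N : cls x = cls y -> frame_unit (F := base_frame R) u x y N = E N x y.
  move=> xy; rewrite /frame_unit bdseq_sumE -(units_from_shift_signs (E N) xy).
  by apply: eq_bigr => g _.
exists u; split=> [g N|q g qL|].
- exact: shift_sign_unitary_le1 (proj1 (hE N)) _.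
- have /tnthP[i ->] : q \in in_tuple L := qL.
  rewrite /GRing.comm -{1 2}(germ_repr (tnth (in_tuple L) i)) -!rmorphM.
  apply/germ_eq/asboolP => e e0.
  have [N0 h0] : exists N0, e^-1 < N0%:R.
    by exists (Num.bound e^-1); apply: archi_boundP; rewrite invr_ge0 ltW.
  exists N0 => N NN; apply: lt_le_trans ((proj2 (hE N)) i g) _.
  rewrite invf_ple ?posrE //; apply: le_trans (ltW h0) _.
  by rewrite ler_nat ltnW.
split=> [x y z w xy zw||x y xy].
- rewrite mulr_natl -rmorphMn -rmorphM.
  have [yz|yz] := eqVneq y z; congr germ; apply: bdseqP => N.
    subst z; rewrite mulr1n bdseq_mulE !uE //; last by rewrite xy.
    by rewrite (unitsM (proj1 (hE N))) // eqxx mul1r.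
  by rewrite mulr0n bdseq_mulE !uE // (unitsM (proj1 (hE N))) // (negbTE yz) mul0r.
- rewrite -raddf_sum -(rmorph1 (@germ R A)); congr germ; apply: bdseqP => N.
  rewrite bdseq_sumE -[RHS](units1 (proj1 (hE N))).
  by apply: eq_bigr => x _; exact: uE.
- rewrite star_germ; congr germ; apply: bdseqP => N /=.
  by rewrite !uE // (units_star (proj1 (hE N))).
Qed.

Lemma exists_realizable (R : realType) (A : cstarAlgType R) (m : nat) :
  approximately_divisible A ->
  exists (J : finType) (F : frame R J), (2 ^ m <= #|J|)%N /\ realizable A F.
Proof.
move=> apx; elim: m => [|m [J [F [cJ hF]]]].
  exists unit, (trivial_frame R); split; last exact: realizable_trivial.
  by rewrite card_unit.
exists (J * bool)%type, (tensor_frame F (base_frame R)); split.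
  by rewrite card_prod card_bool expnSr leq_mul2r.
exact: realizable_tensor hF (realizable_base apx).
Qed.

Lemma exists_realizable_ord (R : realType) (A : cstarAlgType R) (n : nat) :
  approximately_divisible A -> exists F : frame R 'I_n, realizable A F.
Proof.
move=> apx; have [J [F [cJ hF]]] := exists_realizable n apx.
have nJ : (n <= #|J|)%N by apply: leq_trans cJ; apply/ltnW/ltn_expl.
pose h (i : 'I_n) := enum_val (widen_ord nJ i).
have h_inj : injective h.
  by move=> i j /enum_val_inj /(congr1 val) /= ij; apply: val_inj.
by exists (restrict_frame F h_inj); exact: realizable_restrict.
Qed.

(** * Factorization of a matrix over A *)

(** The norm of [a] is a supremum over the unit ball; the factor 4 leaves room
    for columns [x] that are only approximately in it. *)
Lemma mx_norm_le1_bound (R : realType) (A : cstarAlgType R) (n : nat)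
    (a : 'M[A]_n) (x : 'I_n -> A) :
  (cstar_mx_norm a <= 1)%E -> cnorm (\sum_i star (x i) * x i) <= 4 ->
  cnorm (\sum_i star (\sum_j a i j * x j) * (\sum_j a i j * x j)) <= 4.
Proof.
move=> a1 x4.
have quarter (y : 'I_n -> A) : \sum_i star (2^-1 ** y i) * (2^-1 ** y i)
    = 4^-1 ** \sum_i star (y i) * y i.
  rewrite scaler_sumr; apply: eq_bigr => i _.
  by rewrite starZr -scalerAl -scalerAr scalerA -rmorphM; congr ((_%:C)%C *: _); field.
have qnorm (z : A) : cnorm (4^-1 ** z) = 4^-1 * cnorm z.
  by rewrite cnormZr ger0_norm // invr_ge0.
have le1 (z : A) : (Num.sqrt (cnorm (4^-1 ** z)) <= 1) = (cnorm z <= 4).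
  have -> : (Num.sqrt (cnorm (4^-1 ** z)) <= 1)
      = (Num.sqrt (cnorm (4^-1 ** z)) <= Num.sqrt 1) by rewrite sqrtr1.
  by rewrite ler_sqrt ?ltr01 // qnorm ler_pdivrMl // mulr1.
pose x' i := 2^-1 ** x i.
have x'1 : (module_norm x' <= 1)%E by rewrite /module_norm quarter lee_fin le1.
have : (module_norm (mx_act (fun u v : A => (u * v)%R) a x') <= 1)%E.
  apply: le_trans a1; rewrite /cstar_mx_norm /op_norm.
  by apply: ereal_sup_ubound; exists x'.
have -> : mx_act (fun u v : A => u * v) a x' = fun i => 2^-1 ** \sum_j a i j * x j.
  apply/funext => i; rewrite scaler_sumr; apply: eq_bigr => j _.
  by rewrite -scalerAr.
by rewrite /module_norm quarter lee_fin le1.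
Qed.

Lemma null_seq_family (R : realType) (A : cstarAlgType R) (I : finType)
    (x : I -> bdseq A) (e : R) : (forall i, x i \in @null_seq R A) -> 0 < e ->
  exists N0, forall N i, (N0 <= N)%N -> cnorm (x i N) < e.
Proof.
move=> hx e0.
have /choice[N0 h] : forall i, exists N0, forall N, (N0 <= N)%N -> cnorm (x i N) < e.
  by move=> i; have /asboolP := hx i; apply.
exists (\max_i N0 i) => N i NN; apply: h.
by apply: leq_trans NN; exact: leq_bigmax.
Qed.

Section Factorization.
Variables (R : realType) (A : cstarAlgType R).

(** This is an average of products of two matrix units, rather than the matrix
    unit E_(emb j, s) itself, so that [amplify_le] applies to it although the
    relations between matrix units hold only approximately in A. *)
Definition column_elt (J : finType) (F : frame R J) (u : gen F -> A)
    (s : pt F) (j : J) : A :=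
  (csize s)^-1 ** \sum_(x | cls x == cls s)
     frame_unit u (emb (cls s) j) x * frame_unit u x s.

(** The identities for the compression hold in the quotient ring, hence up to
    null sequences in A.  At a large index, a column of the [corner_row k] has
    square p with p^2 close to p, so that p has norm at most 4; hence the
    bound 5 on the square norm of the compression [t]. *)
Lemma approximate_factorization (n : nat) (a : 'M[A]_n.+1) :
  approximately_divisible A -> (cstar_mx_norm a <= 1)%E ->
  exists (F : frame R 'I_n.+1) (u : gen F -> A) (t : A),
    [/\ forall g, cnorm (u g) <= 1, cnorm t ^+ 2 <= 5
      & forall i j, cnorm (a i j
          - \sum_s star (column_elt u s i) * t * column_elt u s j)
          <= n.+1%:R^-1].
Proof.
move=> apx a1; have [F hF] := exists_realizable_ord n.+1 apx.
pose ca i j : bdseq A := const_seq (a i j).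
have [u [u1 ua uE]] := hF [seq germ (ca ij.1 ij.2) | ij : 'I_n.+1 * 'I_n.+1].
pose E x y := germ (frame_unit u x y).
have a_comm i j x y : GRing.comm (germ (ca i j)) (germ (frame_unit u x y)).
  apply: comm_frame_unit => g; apply: ua.
  by apply/mapP; exists (i, j) => //; rewrite mem_enum.
pose xs k : bdseq A := \sum_c frame_unit u (emb c ord0) (emb c k).
pose at_ : bdseq A := \sum_j \sum_k star_seq (xs j) * ca j k * xs k.
pose vs s j : bdseq A := (csize s)^-1 ** \sum_(x | cls x == cls s)
   frame_unit u (emb (cls s) j) x * frame_unit u x s.
pose ps : bdseq A := \sum_k star_seq (xs k) * xs k.
pose ys j : bdseq A := \sum_k ca j k * xs k.
have g_xs k : germ (xs k) = corner_row E ord0 k.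
  by rewrite /xs germ_sum.
have g_at : germ at_ = compression (@aseq_star R A)
    E (fun i j => germ (ca i j)) ord0.
  rewrite germ_sum; apply: eq_bigr => j _; rewrite germ_sum; apply: eq_bigr => k _.
  by rewrite !germM -!g_xs star_germ.
have g_vs s j : germ (vs s j) = column_unit E s j.
  have hk : csize s != 0 by rewrite gt_eqF // csize_gt0.
  rewrite /column_unit /E /vs -[frame_unit u (emb _ _) s]scale1r.
  rewrite -(rmorph1 (real_complex R)) -(mulVf hk) rmorphM -scalerA.
  apply: germZ_eq; rewrite germ_sum.
  have hM := unitsM uE; rewrite /= in hM.
  under eq_bigr => x /eqP xs0 do rewrite germM hM ?cls_emb // eqxx mul1r.
  rewrite sumr_const /csize (rmorph_nat (real_complex R)) scaler_nat raddfMn.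
  by congr (_ *+ _).
have sD := @aseq_starD R A; have sM := @aseq_starM R A.
have null_th i j : ca i j - \sum_s star_seq (vs s i) * at_ * vs s j \in @null_seq R A.
  apply/germ_eq; rewrite (entry_from_compression ord0 sD sM uE a_comm i j) germ_sum.
  by apply: eq_bigr => s _; rewrite !germM -g_at -!g_vs star_germ.
have null_p : star_seq ps * ps - ps \in @null_seq R A.
  apply/germ_eq.
  have e : germ ps
      = \sum_k aseq_star (corner_row E ord0 k) * corner_row E ord0 k.
    by rewrite germ_sum; apply: eq_bigr => k _; rewrite germM -g_xs star_germ.
  by rewrite germM -star_germ e; exact: corner_rows_proj ord0 sD sM uE.
have null_y : star_seq at_ * at_ - \sum_j star_seq (ys j) * ys j \in @null_seq R A.
  apply/germ_eq; rewrite germM -star_germ g_at.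
  rewrite (compression_star_mul ord0 sD sM uE a_comm) germ_sum; apply: eq_bigr => j _.
  rewrite germM -star_germ /ys germ_sum; congr (aseq_star _ * _);
    by apply: eq_bigr => k _; rewrite germM -g_xs.
have [N [thN pN yN]] : exists N,
  [/\ forall i j, cnorm ((ca i j
        - \sum_s star_seq (vs s i) * at_ * vs s j) N) <= n.+1%:R^-1,
      cnorm ((star_seq ps * ps - ps) N) <= 1
    & cnorm ((star_seq at_ * at_ - \sum_j star_seq (ys j) * ys j) N) <= 1].
  have n0 : 0 < n.+1%:R^-1 :> R by rewrite invr_gt0.
  have [N1 h1] := null_seq_family (I := ('I_n.+1 * 'I_n.+1)%type)
    (fun ij => null_th ij.1 ij.2) n0.
  have /asboolP /(_ 1 ltr01) [N2 h2] := null_p.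
  have /asboolP /(_ 1 ltr01) [N3 h3] := null_y.
  exists (maxn N1 (maxn N2 N3)); split=> [i j||]; apply: ltW.
  - by apply: (h1 _ (i, j)); rewrite leq_maxl.
  - by apply: h2; rewrite maxnA maxnAC leq_maxr.
  - by apply: h3; rewrite maxnA leq_maxr.
have uN x y : frame_unit u x y N = frame_unit (fun g => u g N) x y.
  by rewrite /frame_unit bdseq_sumE.
have vN s j : vs s j N = column_elt (fun g => u g N) s j.
  rewrite /vs bdseq_scaleE bdseq_sumE; congr (_ *: _); apply: eq_bigr => x _.
  by rewrite bdseq_mulE !uN.
exists F, (fun g => u g N), (at_ N); split.
- by move=> g.
- have pN4 : cnorm (ps N) <= 4.
    have := cnorm_starM (ps N) => e.
    have : cnorm (star (ps N) * ps N) <= 1 + cnorm (ps N).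
      rewrite -[X in cnorm X](subrK (ps N)); apply: le_trans (cnormD _ _) _.
      by rewrite lerD2r.
    rewrite e; have := cnorm_ge0 (ps N); nra.
  have yN4 : cnorm (\sum_j star (ys j N) * ys j N) <= 4.
    have := mx_norm_le1_bound (x := fun k => xs k N) a1.
    have -> : \sum_k star (xs k N) * xs k N = ps N by rewrite /ps bdseq_sumE.
    move=> /(_ pN4); congr (cnorm _ <= _); apply: eq_bigr => j _.
    by rewrite /ys bdseq_sumE.
  rewrite -cnorm_starM -[X in cnorm X](subrK (\sum_j star (ys j N) * ys j N)).
  apply: le_trans (cnormD _ _) _; rewrite [5](_ : _ = 1 + 4); last by ring.
  apply: lerD => //; move: yN.
  rewrite [X in cnorm X](_ : _
    = star (at_ N) * at_ N - (\sum_j star_seq (ys j) * ys j) N) //.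
  by rewrite (bdseq_sumE _ _ (fun j => star_seq (ys j) * ys j)).
- move=> i j; move: (thN i j).
  rewrite [X in cnorm X](_ : _
    = a i j - (\sum_s star_seq (vs s i) * at_ * vs s j) N) //.
  rewrite (bdseq_sumE _ _ (fun s => star_seq (vs s i) * at_ * vs s j)).
  by under [in X in _ -> X]eq_bigr => s _ do rewrite -!vN.
Qed.

End Factorization.

(** * The estimate of the completely bounded norm *)

Section BoundedHom.
Variables (R : realType) (A : cstarAlgType R) (H : hilbertType R).
Variable pi : A -> H -> H.
Hypothesis pi_hom : is_unital_bounded_hom pi.

Definition hom_const : R := fine (hom_norm pi).

Lemma homD a b u : pi (a + b) u = pi a u + pi b u.
Proof. by rewrite -{1}[a]scale1r (hom_linear pi_hom) scale1r. Qed.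

Lemma hom0l u : pi 0 u = 0.
Proof. by apply: (addIr (pi 0 u)); rewrite -homD !add0r. Qed.

Lemma homZ (c : R[i]) a u : pi (c *: a) u = c *: pi a u.
Proof. by rewrite -[c *: a]addr0 (hom_linear pi_hom) hom0l addr0. Qed.

Lemma hom_sum (I : Type) (r : seq I) (P : pred I) (F : I -> A) u :
  pi (\sum_(i <- r | P i) F i) u = \sum_(i <- r | P i) pi (F i) u.
Proof.
by elim/big_rec2: _ => [|i y1 y2 _ <-]; [exact: hom0l|exact: homD].
Qed.

Lemma hom_opD a u v : pi a (u + v) = pi a u + pi a v.
Proof. by rewrite -{1}[u]scale1r (hom_op_linear pi_hom) scale1r. Qed.

Lemma hom_op0 a : pi a 0 = 0.
Proof. by apply: (addIr (pi a 0)); rewrite -hom_opD !add0r. Qed.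

Lemma hom_opZ a (c : R[i]) u : pi a (c *: u) = c *: pi a u.
Proof.
by rewrite -[c *: u]addr0 (hom_op_linear pi_hom) hom_op0 addr0.
Qed.

Lemma hom_op_sum a (I : Type) (r : seq I) (P : pred I) (F : I -> H) :
  pi a (\sum_(i <- r | P i) F i) = \sum_(i <- r | P i) pi a (F i).
Proof.
by elim/big_rec2: _ => [|i y1 y2 _ <-]; [exact: hom_op0|exact: hom_opD].
Qed.

Lemma rnorm0 : rnorm (0 : H) = 0.
Proof. by rewrite /rnorm normr0. Qed.

Lemma hom_norm_ge0 : (0 <= hom_norm pi)%E.
Proof.
apply: (@le_trans _ _ (bounded_op_norm (pi 0))); last first.
  by apply: ereal_sup_ubound; exists 0 => //=; rewrite cnorm0 lee_fin.
apply: ereal_sup_ubound; exists 0 => //=; first by rewrite rnorm0 lee_fin.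
by rewrite hom0l rnorm0.
Qed.

Lemma hom_constE : hom_norm pi = hom_const%:E.
Proof.
rewrite fineK // fin_numE gt_eqF ?(lt_le_trans _ hom_norm_ge0) ?ltNyr //=.
by rewrite lt_eqF // (hom_bounded pi_hom).
Qed.

Lemma hom_const_ge0 : 0 <= hom_const.
Proof. by rewrite -lee_fin -hom_constE hom_norm_ge0. Qed.

Lemma hom_le a u : rnorm (pi a u) <= hom_const * cnorm a * rnorm u.
Proof.
have [/cnorm_eq0 ->|a0] := eqVneq (cnorm a) 0.
  by rewrite hom0l rnorm0 cnorm0 mulr0 mul0r.
have [/rnorm0_eq0 ->|u0] := eqVneq (rnorm u) 0.
  by rewrite hom_op0 rnorm0 mulr0.
have ap : 0 < cnorm a by rewrite lt_def a0 cnorm_ge0.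
have up : 0 < rnorm u by rewrite lt_def u0 rnorm_ge0.
pose a' := (cnorm a)^-1 ** a; pose u' := (rnorm u)^-1 ** u.
have : ((rnorm (pi a' u'))%:E <= hom_const%:E)%E.
  rewrite -hom_constE; apply: (@le_trans _ _ (bounded_op_norm (pi a'))).
    apply: ereal_sup_ubound; exists u' => //=.
    by rewrite rnormZr ger0_norm ?invr_ge0 ?rnorm_ge0 // mulVf.
  apply: ereal_sup_ubound; exists a' => //=.
  by rewrite cnormZr ger0_norm ?invr_ge0 ?cnorm_ge0 // mulVf.
rewrite lee_fin /a' /u' homZ hom_opZ !rnormZr !ger0_norm ?invr_ge0 ?cnorm_ge0 ?rnorm_ge0 //.
by rewrite mulrA -invfM ler_pdivrMl ?mulr_gt0 // mulrC mulrA.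
Qed.

(** A unital homomorphism has norm at least 1 unless it acts on the zero space. *)
Lemma hom_const_lt1_eq0 : hom_const < 1 -> forall u : H, u = 0.
Proof.
move=> C1 u; apply: rnorm0_eq0; apply/eqP; rewrite eq_le rnorm_ge0 andbT.
have := hom_le 1 u; rewrite (hom1 pi_hom) cnorm1 mulr1.
have := rnorm_ge0 u; have := hom_const_ge0; nra.
Qed.

Section Columns.
Variables (J : finType) (F : frame R J) (g : gen F -> A).
Hypothesis g_le1 : forall x, cnorm (g x) <= 1.
Local Notation C := hom_const.

Let T x := pi (g x).
Let T' x := pi (star (g x)).

Let contraction_le a u : cnorm a <= 1 -> rnorm (pi a u) <= C * rnorm u.
Proof.
move=> a1; apply: le_trans (hom_le _ _) _; rewrite ler_wpM2r ?rnorm_ge0 //.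
by rewrite -[X in _ <= X]mulr1 ler_wpM2l ?hom_const_ge0.
Qed.

Let T_le x u : rnorm (T x u) <= C * rnorm u.
Proof. exact: contraction_le. Qed.

Let T'_le x u : rnorm (T' x u) <= C * rnorm u.
Proof. by apply: contraction_le; rewrite cnorm_star. Qed.

Let unitE x y u : pi (frame_unit g x y) u = unit_op T x y u.
Proof. by rewrite hom_sum; apply: eq_bigr => z _; rewrite homZ. Qed.

Let star_unitE x y u : pi (star (frame_unit g x y)) u = unit_op T' x y u.
Proof.
by rewrite star_sum hom_sum; apply: eq_bigr => z _; rewrite starZr homZ.
Qed.

Lemma hom_column_le (f : J -> H) :
  \sum_s rnorm (\sum_j pi (column_elt g s j) (f j)) ^+ 2
  <= C ^+ 4 * \sum_j rnorm (f j) ^+ 2.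
Proof.
have := @amplify_le R H J F C T T_le (fun x => hom_opD (g x))
  (fun x (r : R) => hom_opZ (g x) _) f.
congr (_ <= _); apply: eq_bigr => s _; congr (rnorm _ ^+ 2).
apply: eq_bigr => j _; rewrite homZ hom_sum; congr (_ *: _).
by apply: eq_bigr => x _; rewrite (homM pi_hom) !unitE.
Qed.

Lemma hom_row_le (f : pt F -> H) :
  \sum_j rnorm (\sum_s pi (star (column_elt g s j)) (f s)) ^+ 2
  <= C ^+ 4 * \sum_s rnorm (f s) ^+ 2.
Proof.
have := @coamplify_le R H J F C T' T'_le (fun x => hom_opD (star (g x)))
  (fun x (r : R) => hom_opZ (star (g x)) _) f.
congr (_ <= _); apply: eq_bigr => j _; congr (rnorm _ ^+ 2).
apply: eq_bigr => s _; rewrite starZr homZ star_sum hom_sum; congr (_ *: _).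
by apply: eq_bigr => x _; rewrite starM (homM pi_hom) !star_unitE.
Qed.

End Columns.

(** The factorization contributes C^2 for each outer factor and C for the middle
    one.  The remaining error, at most 1 / n in each of the n^2 entries,
    contributes at most C.  The constant 4 absorbs 2 * 5 + 2 <= 4 ^ 2, the sum
    of the two contributions to the square norm. *)
Lemma hom_matrix_le (n : nat) (a : 'M[A]_n.+1) (f : 'I_n.+1 -> H) :
  approximately_divisible A -> (cstar_mx_norm a <= 1)%E ->
  \sum_i rnorm (\sum_j pi (a i j) (f j)) ^+ 2
  <= (4 * hom_const ^+ 5) ^+ 2 * \sum_j rnorm (f j) ^+ 2.
Proof.
move=> apx a1; have [F [g [t [g1 t5 th]]]] := approximate_factorization apx a1.
set C := hom_const; set S := \sum_j rnorm (f j) ^+ 2.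
have S0 : 0 <= S by apply: sumr_ge0 => j _; rewrite sqr_ge0.
(* C >= 1 is needed to compare C^2, from the error term, with C^10 *)
have [C1|C1] := ltP C 1.
  rewrite big1 => [|i _].
    by rewrite mulr_ge0 // sqr_ge0.
  by rewrite (hom_const_lt1_eq0 C1 (\sum_j _)) rnorm0 expr0n.
pose b i j := \sum_s star (column_elt g s i) * t * column_elt g s j.
pose z s := \sum_j pi (column_elt g s j) (f j).
have z_le : \sum_s rnorm (z s) ^+ 2 <= C ^+ 4 * S by exact: hom_column_le.
have B_le : \sum_i rnorm (\sum_j pi (b i j) (f j)) ^+ 2 <= 5 * C ^+ 10 * S.
  have -> : \sum_i rnorm (\sum_j pi (b i j) (f j)) ^+ 2
      = \sum_i rnorm (\sum_s pi (star (column_elt g s i)) (pi t (z s))) ^+ 2.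
    apply: eq_bigr => i _; congr (rnorm _ ^+ 2).
    under eq_bigr => j _ do rewrite hom_sum.
    rewrite exchange_big; apply: eq_bigr => s _ /=.
    rewrite !hom_op_sum; apply: eq_bigr => j _.
    by rewrite -mulrA !(homM pi_hom).
  apply: le_trans (hom_row_le g1 _) _.
  have tz s : rnorm (pi t (z s)) ^+ 2 <= 5 * C ^+ 2 * rnorm (z s) ^+ 2.
    have h : rnorm (pi t (z s)) ^+ 2 <= (C * cnorm t * rnorm (z s)) ^+ 2.
      by rewrite lerXn2r ?nnegrE ?(le_trans _ (hom_le _ _)) ?rnorm_ge0 ?hom_le.
    apply: le_trans h _; rewrite !exprMn ler_wpM2r ?sqr_ge0 // mulrC.
    by rewrite ler_wpM2r ?sqr_ge0.
  have -> : 5 * C ^+ 10 * S = C ^+ 4 * (5 * C ^+ 2 * (C ^+ 4 * S)) by ring.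
  rewrite ler_wpM2l ?exprn_ge0 ?hom_const_ge0 //.
  apply: le_trans (ler_sum _ (fun s _ => tz s)) _.
  by rewrite -mulr_sumr ler_wpM2l // mulr_ge0 ?sqr_ge0.
have A_le : \sum_i rnorm (\sum_j pi (a i j - b i j) (f j)) ^+ 2 <= C ^+ 2 * S.
  have n0 : n.+1%:R != 0 :> R by rewrite pnatr_eq0.
  have row i : rnorm (\sum_j pi (a i j - b i j) (f j)) ^+ 2
      <= n.+1%:R^-1 * (C ^+ 2 * S).
    apply: le_trans (rnorm_sum_sqr_le _) _; rewrite card_ord.
    rewrite -(ler_pM2l (_ : 0 < n.+1%:R^-1 :> R)) ?invr_gt0 // mulKf //.
    rewrite mulrA -expr2 !mulr_sumr; apply: ler_sum => j _.
    rewrite mulrA -!exprMn lerXn2r ?nnegrE ?rnorm_ge0 //.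
      by rewrite !mulr_ge0 ?invr_ge0 ?hom_const_ge0 ?rnorm_ge0.
    apply: le_trans (hom_le _ _) _; rewrite ler_wpM2r ?rnorm_ge0 // mulrC.
    by rewrite ler_wpM2r ?hom_const_ge0.
  apply: le_trans (ler_sum _ (fun i _ => row i)) _.
  by rewrite sumr_const card_ord -[X in X <= _]mulr_natl mulVKf.
have split_le i : rnorm (\sum_j pi (a i j) (f j)) ^+ 2
    <= rnorm (\sum_j pi (a i j - b i j) (f j)) ^+ 2 *+ 2
       + rnorm (\sum_j pi (b i j) (f j)) ^+ 2 *+ 2.
  apply: le_trans (rnormD_sqr_le _ _); rewrite -big_split /=.
  by under [in X in _ <= X]eq_bigr => j _ do rewrite -homD subrK.
apply: le_trans (ler_sum _ (fun i _ => split_le i)) _.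
rewrite big_split /= !sumrMnl.
have CC : C ^+ 2 * S <= C ^+ 10 * S by rewrite ler_wpM2r // ler_weXn2l.
have C10 : 0 <= C ^+ 10 * S by rewrite mulr_ge0 // exprn_ge0 // hom_const_ge0.
rewrite exprMn -exprM; move: A_le B_le; rewrite !mulr2n; lra.
Qed.

Lemma hom_cb_norm_le : approximately_divisible A ->
  (hom_cb_norm pi <= 4%:E * hom_norm pi `^ 5)%E.
Proof.
move=> apx; rewrite hom_constE poweR_EFin powR_mulrn ?hom_const_ge0 // -EFinM.
apply: ge_ereal_sup => _ [n n1 <-]; apply: ge_ereal_sup => _ [a a1 <-].
apply: ge_ereal_sup => _ [f f1 <-].
case: n n1 a a1 f f1 => // n _ a a1 f; rewrite /= /hsum_norm lee_fin => f1.
rewrite lee_fin.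
have C0 : 0 <= 4 * hom_const ^+ 5 by rewrite mulr_ge0 // exprn_ge0 // hom_const_ge0.
rewrite -[X in _ <= X]ger0_norm // -sqrtr_sqr ler_wsqrtr //.
have S1 : \sum_i rnorm (f i) ^+ 2 <= 1.
  by move: f1; rewrite -{1}(sqrtr1 R) ler_sqrt.
apply: (@le_trans _ _ ((4 * hom_const ^+ 5) ^+ 2 * \sum_j rnorm (f j) ^+ 2)).
  have := hom_matrix_le f apx a1; congr (_ <= _); apply: eq_bigr => i _.
  by congr (rnorm _ ^+ 2); apply: eq_bigr => j _; rewrite mxE.
by rewrite -[X in _ <= X]mulr1 ler_wpM2l ?sqr_ge0.
Qed.

End BoundedHom.

Theorem theorem5p1 (R : realType) (A : cstarAlgType R) :
  separable A -> approximately_divisible A ->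
  (similarity_degree A <= 5%:E)%E /\ similarity_exponent A 5.
Proof.
move=> _ apx; have h5 : similarity_exponent A 5.
  split; first by rewrite ler0n.
  by exists 4 => H pi hpi; exact: hom_cb_norm_le.
split=> //; apply: ereal_inf_lbound; exists 5 => //.
Qed.
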